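(* The algorithm described in the context (VB-FTRL for LL-OLQS) achieves a regret rate of $O(d^2\log(T+d))$ with $\lambda=300$ and $\mu=10$.
   Context: $\mathcal D_d$ is the set of density matrices in $\mathbb C^{d\times d}$ (Hermitian positive semidefinite, unit trace). Online learning of quantum states with the logarithmic loss (LL-OLQS) is the following game with $T$ rounds between Physicist and Reality. In the $t$-th round, Physicist announces $\rho_t\in\mathcal D_d$; then Reality announces a Hermitian positive semidefinite matrix $A_t\in\mathbb C^{d\times d}$; then Physicist suffers the loss $f_t(\rho_t)$, where $f_t(\rho):=-\log\operatorname{tr}(A_t\rho)$. The regret, to be bounded against all possible strategies of Reality, is $$\mathrm{Regret}_T:=\sum_{t=1}^T f_t(\rho_t)-\min_{\rho\in\mathcal D_d}\sum_{t=1}^T f_t(\rho).$$ Notation: $\mathcal H^d$ is the real Hilbert space of $d\times d$ Hermitian matrices with the Hilbert–Schmidt inner product; $\mathrm{vec}(M)\in\mathbb C^{d^2}$ stacks the columns of $M$. For a real-valued function $\varphi$ of Hermitian matrices, $\overline\varphi$ is the function with $\overline\varphi(\mathrm{vec}(M))=\varphi(M)$, and $\nabla^2\overline\varphi(\mathrm{vec}(M))$ is the unique $d^2\times d^2$ complex matrix with $D^2\varphi(M)[V,U]=\langle\mathrm{vec}(V),\nabla^2\overline\varphi(\mathrm{vec}(M))\,\mathrm{vec}(U)\rangle$ for all $U,V\in\mathcal H^d$, where $\langle a,b\rangle=a^*b$. Let $R(\rho):=-\log\det\rho$. Algorithm (played by Physicist, with parameters $\lambda,\mu>0$): let $P_0(\rho):=\lambda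 R(\rho)$. At the $t$-th round the algorithm outputs $\rho_t\in\operatorname{argmin}_{\rho\in\mathcal D_d}P_{t-1}(\rho)$, where $$P_t(\rho):=L_t(\rho)+\mu V_t(\rho),\quad L_t(\rho):=\sum_{\tau=1}^t f_\tau(\rho)+\lambda R(\rho),\quad V_t(\rho):=\tfrac12\log\det\nabla^2\overline L_t(\mathrm{vec}(\rho)).$$ *)

(* Defs.v *)
From HB Require Import structures.
From mathcomp Require Import all_boot all_order all_algebra.
From mathcomp Require Import spectral sesquilinear.
From mathcomp Require Import complex.
From mathcomp Require Import all_classical all_reals all_analysis.

Set Implicit Arguments.
Unset Strict Implicit.
Unset Printing Implicit Defensive.

Import Order.TTheory GRing.Theory Num.Theory.
Import numFieldNormedType.Exports.

Local Open Scope classical_set_scope.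
Local Open Scope ring_scope.
Local Open Scope complex_scope.
Local Open Scope sesquilinear_scope.

Section VBFTRL.
Context {R : realType} {d : nat}.

(* For R[i], [0 <= z] means that z is real and nonnegative. *)
Definition psd (A : 'M[R[i]]_d) : Prop :=
  A \is hermsymmx /\
  forall v : 'cV[R[i]]_d, 0 <= (v ^t* *m A *m v) 0 0.

Definition density : set 'M[R[i]]_d := [set rho | psd rho /\ \tr rho = 1].

(* [lne x = -oo] for [x <= 0], so the loss is +oo where tr(A rho) = 0.  The
   trace is real when A and rho are Hermitian. *)
Definition loss (A rho : 'M[R[i]]_d) : \bar R :=
  (- lne (complex.Re (\tr (A *m rho)))%:E)%E.

(* The regulariser R(rho) = - log det rho, equal to +oo on singular density
   matrices. *)
Definition logdet_reg (rho : 'M[R[i]]_d) : \bar R :=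
  (- lne (complex.Re (\det rho))%:E)%E.

(* [mxvec] lists a matrix row by row, hence the transpose. *)
Definition vec (M : 'M[R[i]]_d) : 'cV[R[i]]_(d * d) := (mxvec M^T)^T.

(* D^2 phi(M)[V, U], along real multiples of the directions. *)
Definition D2 (phi : 'M[R[i]]_d -> R) (M V U : 'M[R[i]]_d) : R :=
  derive1 (fun s : R =>
    derive1 (fun r : R => phi (M + s%:C *: V + r%:C *: U)) 0) 0.

Definition is_hessian (phi : 'M[R[i]]_d -> R) (M : 'M[R[i]]_d)
    (G : 'M[R[i]]_(d * d)) : Prop :=
  forall U V : 'M[R[i]]_d, U \is hermsymmx -> V \is hermsymmx ->
    (D2 phi M V U)%:C = ((vec V) ^t* *m (G *m vec U)) 0 0.

(* At most one matrix satisfies [is_hessian phi M], because the vectors [vec V]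
   with V Hermitian span C^(d^2) over C; [0] is a dummy value used when there
   is none. *)
Definition hessian (phi : 'M[R[i]]_d -> R) (M : 'M[R[i]]_d)
  : 'M[R[i]]_(d * d) := xget 0 [set G | is_hessian phi M G].

Section Algorithm.
Variables (lam mu : R) (A : nat -> 'M[R[i]]_d).

Definition Lt (t : nat) (rho : 'M[R[i]]_d) : \bar R :=
  ((\sum_(1 <= tau < t.+1) loss (A tau) rho) + lam%:E * logdet_reg rho)%E.

(* Differentiation needs a real-valued function; [fine] is the identity on the
   open set of Hermitian matrices where [Lt t] is finite.  Where [Lt t] is
   infinite the value of [Vt t] is real but meaningless, and [Pt t] is then +oo
   on density matrices whatever that value is. *)
Definition Vt (t : nat) (rho : 'M[R[i]]_d) : R :=
  2^-1 * ln (complex.Re (\det (hessian (fun M => fine (Lt t M)) rho))).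

Definition Pt (t : nat) (rho : 'M[R[i]]_d) : \bar R :=
  if t is 0%N then (lam%:E * logdet_reg rho)%E
  else (Lt t rho + (mu * Vt t rho)%:E)%E.

End Algorithm.

Definition argmin_density (F : 'M[R[i]]_d -> \bar R) : set 'M[R[i]]_d :=
  [set rho | density rho /\ forall sigma, density sigma -> (F rho <= F sigma)%E].

(* A T-round play, with rounds numbered 1, ..., T, in which Reality announces
   the matrices [A t] and Physicist follows the algorithm, with any choice of
   minimisers.  A strategy of Reality may choose [A t] in view of
   [rho 1, ..., rho t]; every play against such a strategy is of this form. *)
Definition vbftrl_play (lam mu : R) (T : nat)
    (A rho : nat -> 'M[R[i]]_d) : Prop :=
  forall t, (1 <= t <= T)%N ->
    psd (A t) /\ argmin_density (Pt lam mu A t.-1) (rho t).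

(* The infimum is attained, the cumulative loss being lower semicontinuous on
   the compact set of density matrices.  It is +oo only if some [A t] is zero,
   in which case the regret has the form +oo - +oo (-oo in this library). *)
Definition regret (T : nat) (A rho : nat -> 'M[R[i]]_d) : \bar R :=
  ((\sum_(1 <= t < T.+1) loss (A t) (rho t))
   - ereal_inf [set \sum_(1 <= t < T.+1) loss (A t) sigma
               | sigma in density])%E.

End VBFTRL.

(* Main.v *)
(* Along the segment between two positive definite matrices [x = S S^*] and
   [y = S diag(q) S^*], the Hessian of [L_t] is a combination of fixed rank-one
   matrices whose weights are inverse squares, or inverse products of two, of
   positive affine functions.  By the Cauchy-Binet formula its determinant is a
   nonnegative combination of products of these weights; such products are
   log-convex, hence so is the sum, and [V_t] is convex along the segment.

   Let [x = rho_t] minimise [P_(t-1)].  Since [V_(t-1)] is convex,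
   [P_(t-1) y - P_(t-1) x] is at least the Bregman divergence [B] of [L_(t-1)].
   The rank-one update from [t-1] to [t] increases [V] at [y] by at least
   [ln (1 + u^2 / r^2) / 2], where [u = 1 - tr(A x) / tr(A y)] and [r] is the
   norm of [y - x] in the Hessian at [y].  A scalar inequality,
   [ln (tr(A y) / tr(A x)) <= B + (mu / 2) ln (1 + u^2 / r^2)], then gives
   [P_t y >= P_(t-1) x + f_t x].  Iterating bounds the cumulative loss by
   [P_T y] for every positive definite density matrix [y]; take for [y] a
   mixture of the comparator with weight [1 / (T + 1)] of the uniform state. *)
Require Import Defs.
From mathcomp Require Import all_boot all_order all_algebra perm.
From mathcomp Require Import spectral sesquilinear.
From mathcomp Require Import complex.
From mathcomp Require Import all_classical all_reals all_analysis.
From mathcomp Require Import ring lra.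

Set Implicit Arguments.
Unset Strict Implicit.
Unset Printing Implicit Defensive.

Import Order.TTheory GRing.Theory Num.Theory.
Import numFieldNormedType.Exports.

Local Open Scope classical_set_scope.
Local Open Scope ring_scope.
Local Open Scope sesquilinear_scope.

(** * Positive semidefinite matrices *)

Section hermitian_matrices.
Variable C : numClosedFieldType.

(** Minimality of [x] is only used on the segment from [x] to [y]. Combined with the chord
    inequality for [V], it gives a one-sided first-order condition in which [V] occurs only through
    [V y - V x]; [V] is never differentiated. After simultaneous diagonalisation, [L] on the segment
    is a constant minus a weighted sum of terms [ln (1 + s * eta k)], one per past observation
    (weight 1) and one per eigenvalue (weight 300). Both [B] and [r^2] are then sums over the same
    indices and can be compared term by term.

    The comparison [r^2 <= 16 B] can fail only if some ratio [1 + eta k] is far from 1, and then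
    [B >= 1/16]; hence the alternative in the hypotheses of the scalar inequality. The weight 300
    matters because the trace ratio is at most some eigenvalue ratio: it makes [B] alone sufficient
    unless the trace ratio is close to 1.

    Two degenerate cases shape the statements. [P_0] has no volumetric term, so the first round
    needs [V_0 >= 0] on density matrices. A zero matrix announced by Reality makes every
    comparator's loss infinite and is treated apart. *)

Lemma trmxCM m n p (A : 'M[C]_(m, n)) (B : 'M[C]_(n, p)) :
  (A *m B)^t* = B^t* *m A^t*.
Proof. by rewrite trmx_mul map_mxM. Qed.

Lemma trmxCE m n (A : 'M[C]_(m, n)) i j : A^t* i j = (A j i)^*.
Proof. by rewrite !mxE. Qed.

Lemma trace_trmxC n (M : 'M[C]_n) : \tr (M^t*) = (\tr M)^*.
Proof. by rewrite -map_trmx mxtrace_tr trace_map_mx. Qed.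

Lemma hermP n (A : 'M[C]_n) : reflect (A^t* = A) (A \is hermsymmx).
Proof.
apply: (iffP (is_hermitianmxP _ _ _)); rewrite expr0 scale1r.
  by move=> {1}<-.
by move=> ->.
Qed.

Lemma hermE n (A : 'M[C]_n) : A \is hermsymmx -> A^t* = A.
Proof. by move/hermP. Qed.

Lemma herm_diagonalize n (A : 'M[C]_n) : A \is hermsymmx ->
  exists (U : 'M[C]_n) (q : 'I_n -> C),
    [/\ U *m U^t* = 1%:M, U^t* *m U = 1%:M, forall i, q i \is Num.real
     & A = U *m diag_mx (\row_i q i) *m U^t*].
Proof.
move=> Ah; have /orthomx_spectralP AE := hermitian_normalmx Ah.
have Uu := spectral_unitarymx A.
exists ((spectralmx A)^t*); exists (fun i => spectral_diag A 0 i); split.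
- by rewrite trmxCK -(invmx_unitary Uu) mulVmx // unitarymx_unit.
- by rewrite trmxCK; apply/unitarymxP.
- by move=> i; have /mxOverP := hermitian_spectral_diag_real Ah; apply.
rewrite trmxCK {1}AE invmx_unitary //; congr (_ *m diag_mx _ *m _).
by apply/rowP => i; rewrite mxE.
Qed.

(* Symmetrised Cauchy-Binet formula: the coefficient of [w (f 0) * w (f 1) * ...]
   is [|det (b (f i))_i|^2 / n!]. *)
Lemma det_weighted_sum n (K : finType) (b : K -> 'cV[C]_n) :
  exists2 c : {ffun 'I_n -> K} -> C, (forall f, 0 <= c f) &
  forall w : K -> C, \det (\sum_k w k *: (b k *m (b k)^t*)) =
    \sum_f c f * \prod_i w (f i).
Proof.
pose B (f : {ffun 'I_n -> K}) : 'M[C]_n := \matrix_(i, j) b (f i) j 0.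
exists (fun f => `|\det (B f)| ^+ 2 / (n`!)%:R).
  by move=> f; rewrite divr_ge0 ?exprn_ge0 ?ler0n.
move=> w.
have n0 : (n`!)%:R != 0 :> C by rewrite pnatr_eq0 -lt0n fact_gt0.
pose X (f : {ffun 'I_n -> K}) := (\prod_i w (f i)) * (\prod_i B f i i) * (\det (B f))^* .
have -> : \det (\sum_k w k *: (b k *m (b k)^t*)) = \sum_f X f.
  transitivity (\sum_(s : 'S_n) \sum_(f : {ffun 'I_n -> K})
      (-1) ^+ s * \prod_i (w (f i) * (b (f i) i 0 * (b (f i) (s i) 0)^* ))).
    apply: eq_bigr => s _; rewrite -mulr_sumr; congr (_ * _).
    rewrite -(bigA_distr_bigA (fun i k => w k * (b k i 0 * (b k (s i) 0)^* ))).
    apply: eq_bigr => i _; rewrite summxE; apply: eq_bigr => k _.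
    by rewrite !mxE big_ord1 !mxE.
  rewrite exchange_big /=; apply: eq_bigr => f _.
  rewrite /X /determinant rmorph_sum mulr_sumr; apply: eq_bigr => s _.
  rewrite !big_split /= rmorphM rmorphXn rmorphN1 rmorph_prod.
  rewrite [RHS]mulrCA !mulrA; congr (_ * _ * _ * _).
  - by apply: eq_bigr => i _; rewrite mxE.
  - by apply: eq_bigr => i _; rewrite mxE.
(* The terms [X f] are not symmetric in [f]. Summing over the [n!] reindexings turns the product of
   diagonal entries of [B f] into its determinant, which meets the conjugate already present. *)
have reidx (t : 'S_n) : \sum_f X f = \sum_(f : {ffun 'I_n -> K}) X [ffun i => f (t i)].
  rewrite (reindex (fun f : {ffun 'I_n -> K} => [ffun i => f (t i)])) //=.
  exists (fun f : {ffun 'I_n -> K} => [ffun i => f (t^-1%g i)]) => f _;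
    by apply/ffunP => i; rewrite !ffunE ?permK ?permKV.
apply: (mulIf n0); rewrite mulr_natr -[n`!]card_Sn -sumr_const.
rewrite (eq_bigr _ (fun t _ => reidx t)) exchange_big /= mulr_suml.
apply: eq_bigr => f _.
have XE (t : 'S_n) : X [ffun i => f (t i)] =
    (\prod_i w (f i)) * (\det (B f))^*  * ((-1) ^+ t * \prod_i (B f)^T i (t i)).
  have BE : B [ffun i => f (t i)] = row_perm t (B f).
    by apply/matrixP => i j; rewrite !mxE ffunE.
  rewrite /X BE row_permE det_mulmx det_perm rmorphM rmorphXn rmorphN1.
  have -> : \prod_i w ([ffun i => f (t i)] i) = \prod_i w (f i).
    rewrite [RHS](reindex_inj (@perm_inj _ t)) /=.
    by apply: eq_bigr => i _; rewrite ffunE.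
  have -> : \prod_i (perm_mx t *m B f) i i = \prod_i (B f)^T i (t i).
    by apply: eq_bigr => i _; rewrite -row_permE !mxE.
  by rewrite -!mulrA; congr (_ * _); rewrite mulrCA [RHS]mulrCA; congr (_ * _);
     rewrite mulrC.
rewrite (eq_bigr _ (fun t _ => XE t)) -mulr_sumr -/(determinant _) det_tr.
move: n0; rewrite normCK card_Sn => n0.
by field.
Qed.

(** Matrix determinant lemma: [M] is factored through each of its two Schur complements. *)
Lemma det_rank1_update n (G : 'M[C]_n) (g : 'cV[C]_n) : G \in unitmx ->
  \det (G + g *m g^t*) = \det G * (1 + (g^t* *m invmx G *m g) 0 0).
Proof.
move=> Gu; pose M : 'M[C]_(n + 1) := block_mx G (- g) (g^t*) 1%:M.
transitivity (\det M).
  have -> : M = block_mx 1%:M (- g) 0 1%:M *m block_mx (G + g *m g^t*) 0 (g^t*) 1%:M.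
    rewrite mulmx_block !(mul1mx, mul0mx, mulmx0, mulmx1, add0r, mulNmx).
    by rewrite addrK.
  by rewrite det_mulmx det_ublock det_lblock !det1 !mul1r mulr1.
have -> : M = block_mx 1%:M 0 (g^t* *m invmx G) 1%:M
           *m block_mx G (- g) 0 (1%:M + g^t* *m invmx G *m g).
  rewrite mulmx_block !(mul1mx, mul0mx, mulmx0, addr0).
  by rewrite mulmxKV // mulmxN addrCA addNr addr0.
rewrite det_mulmx det_ublock det_lblock !det1 !mul1r; congr (_ * _).
by rewrite det_mx11 !mxE eqxx.
Qed.

(* [psd] over an arbitrary closed field; convertible to it over [R[i]]. *)
Definition psdmx n (A : 'M[C]_n) : Prop :=
  A \is hermsymmx /\ forall v : 'cV[C]_n, 0 <= (v^t* *m A *m v) 0 0.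

(** Cauchy-Schwarz for the form [G], applied to [h = G^-1 g] and [v], bounds the quadratic term of
    the determinant lemma from below. *)
Lemma det_rank1_update_ge n (G : 'M[C]_n) (g v : 'cV[C]_n) :
  psdmx G -> 0 < \det G -> 0 < (v^t* *m G *m v) 0 0 ->
  \det G * (1 + `|(g^t* *m v) 0 0| ^+ 2 / (v^t* *m G *m v) 0 0)
    <= \det (G + g *m g^t*).
Proof.
move=> [/hermP Gh Gp] dG a0.
have Gu : G \in unitmx by rewrite unitmxE unitfE gt_eqF.
rewrite (det_rank1_update _ Gu) ler_pM2l // lerD2l.
set h := invmx G *m g.
have gE : g = G *m h by rewrite mulKVmx.
have gtE : g^t* = h^t* *m G by rewrite gE trmxCM Gh.
set a := (_ *m v) 0 0 in a0 *.
have hE : (g^t* *m invmx G *m g) 0 0 = (h^t* *m G *m h) 0 0.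
  by rewrite gtE mulmxK // {1}gE mulmxA.
rewrite hE gtE ler_pdivrMr //; clearbody h.
set e := (h^t* *m G *m v) 0 0; set f := (h^t* *m G *m h) 0 0.
have eC : (v^t* *m G *m h) 0 0 = e^*.
  by rewrite /e -trmxCE !trmxCM trmxCK Gh mulmxA.
have aC : a^* = a by apply/CrealP/ger0_real/ltW.
(* This vector is [a] times the component of [h] that is [G]-orthogonal to [v]. *)
have := Gp (a *: h - e^* *: v).
have -> : ((a *: h - e^* *: v)^t* *m G *m (a *: h - e^* *: v)) 0 0
    = a * (a * f - `|e| ^+ 2).
  have -> : (a *: h - e^* *: v)^t* = a *: h^t* - e *: v^t*.
    by apply/rowP => i; rewrite !mxE rmorphB !rmorphM /= aC conjCK.
  have -> : (a *: h^t* - e *: v^t*) *m G *m (a *: h - e^* *: v) =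
      a *: (a *: (h^t* *m G *m h)) - e^* *: (a *: (h^t* *m G *m v))
      - (e *: (a *: (v^t* *m G *m h)) - e^* *: (e *: (v^t* *m G *m v))).
    rewrite !mulmxBl mulmxBr mulmxBr -!scalemxAl -!scalemxAr.
    by rewrite !(scalerA a) !(scalerA e) !(scalerA e^* ) ![_ * a]mulrC ![_ * e]mulrC.
  have E3 (P Q S T : 'M[C]_1) (p q : C) :
      (a *: (a *: P) - p *: (a *: Q) - (q *: (a *: S) - p *: (q *: T))) 0 0 =
      a * (a * P 0 0) - p * (a * Q 0 0) - (q * (a * S 0 0) - p * (q * T 0 0)).
    by rewrite !mxE.
  rewrite E3 -/e -/f -/a eC normCK; ring.
by rewrite pmulr_rge0 // subr_ge0 mulrC.
Qed.

Lemma psdmx_congr m n (A : 'M[C]_n) (S : 'M[C]_(n, m)) :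
  psdmx A -> psdmx (S^t* *m A *m S).
Proof.
move=> [/hermP Ah Ap]; split; first by apply/hermP; rewrite !trmxCM trmxCK Ah mulmxA.
by move=> v; have := Ap (S *m v); rewrite trmxCM !mulmxA.
Qed.

Lemma psdmx_diag_ge0 n (A : 'M[C]_n) i : psdmx A -> 0 <= A i i.
Proof.
move=> [_ /(_ (delta_mx i 0))].
have -> : (delta_mx i 0 : 'cV[C]_n)^t* = delta_mx 0 i.
  by rewrite trmx_delta map_delta_mx.
by rewrite -rowE -colE !mxE.
Qed.

Lemma psdmx_diagonalize n (A : 'M[C]_n) : psdmx A ->
  exists (U : 'M[C]_n) (q : 'I_n -> C),
    [/\ U *m U^t* = 1%:M, U^t* *m U = 1%:M, forall i, 0 <= q i
     & A = U *m diag_mx (\row_i q i) *m U^t*].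
Proof.
move=> Apsd; have [U [q [U1 U2 _ AE]]] := herm_diagonalize Apsd.1.
exists U, q; split=> // i.
have := psdmx_diag_ge0 i (psdmx_congr U Apsd).
rewrite AE !mulmxA U2 mul1mx -mulmxA U2 mulmx1.
by rewrite !mxE eqxx mulr1n.
Qed.

Lemma unitary_trdet n (U : 'M[C]_n) (q : 'I_n -> C) : U^t* *m U = 1%:M ->
  \tr (U *m diag_mx (\row_i q i) *m U^t*) = \sum_i q i /\
  \det (U *m diag_mx (\row_i q i) *m U^t*) = \prod_i q i.
Proof.
move=> U1; split.
  rewrite mxtrace_mulC mulmxA U1 mul1mx mxtrace_diag.
  by apply: eq_bigr => i _; rewrite mxE.
rewrite !det_mulmx mulrAC [\det U * _]mulrC -det_mulmx U1 det1 mul1r det_diag.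
by apply: eq_bigr => i _; rewrite mxE.
Qed.

Lemma psdmx_tr_ge0 n (A : 'M[C]_n) : psdmx A -> 0 <= \tr A.
Proof. by move=> Ap; apply: sumr_ge0 => i _; apply: psdmx_diag_ge0. Qed.

(** Every eigenvalue is at most the trace. The bound is later used under a logarithm, so the AM-GM
    factor can be spared. *)
Lemma psdmx_det_le_tr n (A : 'M[C]_n) : psdmx A -> 0 <= \det A <= (\tr A) ^+ n.
Proof.
move=> /psdmx_diagonalize[U [q [_ U1 q0 ->]]].
have [-> ->] := unitary_trdet q U1; rewrite prodr_ge0 //=.
have -> : (\sum_i q i) ^+ n = \prod_(i < n) \sum_i q i.
  by rewrite prodr_const card_ord.
apply: ler_prod => i _.
by rewrite q0 /= (bigD1 i) //= lerDl sumr_ge0.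
Qed.

Lemma psdmx_tr_sqr n (A : 'M[C]_n) : psdmx A -> 0 <= \tr (A *m A) <= (\tr A) ^+ 2.
Proof.
move=> /psdmx_diagonalize[U [q [_ U1 q0 ->]]].
have [-> _] := unitary_trdet q U1.
have -> : U *m diag_mx (\row_i q i) *m U^t* *m (U *m diag_mx (\row_i q i) *m U^t*)
    = U *m diag_mx (\row_i (q i) ^+ 2) *m U^t*.
  rewrite !mulmxA -[_ *m U^t* *m U]mulmxA U1 mulmx1 -[U *m _ *m diag_mx _]mulmxA.
  rewrite mulmx_diag; congr (_ *m diag_mx _ *m _).
  by apply/rowP => i; rewrite !mxE.
have [-> _] := unitary_trdet (fun i => q i ^+ 2) U1.
rewrite sumr_ge0 => [|i _]; last by rewrite exprn_ge0.
rewrite /= expr2 mulr_suml; apply: ler_sum => i _.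
by rewrite expr2 ler_wpM2l // (bigD1 i) //= lerDl sumr_ge0.
Qed.

Lemma herm_tr_sqr n (A : 'M[C]_n) : A \is hermsymmx ->
  \tr (A *m A) = \sum_i \sum_j `|A i j| ^+ 2.
Proof.
move=> /hermP Ah; apply: eq_bigr => i _; rewrite mxE; apply: eq_bigr => j _.
by rewrite normCK -trmxCE Ah.
Qed.

(** [tr (A A)] is squeezed to 0, and it is the squared Frobenius norm of [A]. *)
Lemma psdmx_tr_eq0 n (A : 'M[C]_n) : psdmx A -> \tr A = 0 -> A = 0.
Proof.
move=> Ap A0; have := psdmx_tr_sqr Ap; rewrite A0 expr0n /= => /le_anti.
rewrite (herm_tr_sqr Ap.1) => /esym/eqP; rewrite psumr_eq0 => [/allP h|i _]; last first.
  by apply: sumr_ge0 => j _; rewrite exprn_ge0.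
apply/matrixP => i j; rewrite mxE; apply/eqP.
have := h i (mem_index_enum i); rewrite psumr_eq0 => [/allP /(_ j (mem_index_enum j))|k _].
  by rewrite expf_eq0 normr_eq0.
by rewrite exprn_ge0.
Qed.

Lemma unitmx_trmxC n (S : 'M[C]_n) : (S^t* \in unitmx) = (S \in unitmx).
Proof. by rewrite map_unitmx unitmx_tr. Qed.

Lemma psdmx_tr_mul_ge0 n (A S : 'M[C]_n) : psdmx A -> 0 <= \tr (A *m (S *m S^t*)).
Proof.
by move=> Ap; rewrite mulmxA mxtrace_mulC mulmxA psdmx_tr_ge0 //; apply: psdmx_congr.
Qed.

Lemma psdmx_tr_mul_gt0 n (A S : 'M[C]_n) : psdmx A -> A != 0 -> S \in unitmx ->
  0 < \tr (A *m (S *m S^t*)).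
Proof.
move=> Ap A0 Su; rewrite lt_def psdmx_tr_mul_ge0 // andbT.
apply: contra_neq A0; rewrite mulmxA mxtrace_mulC mulmxA => h.
have /(congr1 (fun M => invmx (S^t*) *m M *m invmx S)) := psdmx_tr_eq0 (psdmx_congr S Ap) h.
by rewrite mulmx0 mul0mx !mulmxA mulVmx ?unitmx_trmxC // mul1mx mulmxK.
Qed.

Lemma psdmx_sqr n (A : 'M[C]_n) : psdmx A -> \det A != 0 ->
  exists2 S, S \in unitmx & A = S *m S^t*.
Proof.
move=> /psdmx_diagonalize[U [q [_ U1 q0 ->]]].
have [_ dE] := unitary_trdet q U1; rewrite {}dE => /prodf_neq0 qn0.
have Uu : U \in unitmx by case/mulmx1_unit: U1.
exists (U *m diag_mx (\row_i sqrtC (q i))).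
  rewrite unitmx_mul Uu unitmxE det_diag unitfE; apply/prodf_neq0 => i _.
  by rewrite mxE sqrtC_eq0 qn0.
rewrite trmxCM !mulmxA; congr (_ *m _).
have -> : (diag_mx (\row_i sqrtC (q i)))^t* = diag_mx (\row_i sqrtC (q i)) :> 'M[C]_n.
  rewrite tr_diag_mx map_diag_mx; congr diag_mx; apply/rowP => i; rewrite !mxE.
  by apply/CrealP/ger0_real; rewrite sqrtC_ge0.
rewrite -mulmxA mulmx_diag; congr (_ *m diag_mx _); apply/rowP => i.
by rewrite !mxE -expr2 sqrtCK.
Qed.

(* Congruence by [S^-1], then unitary diagonalisation. *)
Lemma simultaneous_diagonalization n (S B : 'M[C]_n) :
  S \in unitmx -> B \is hermsymmx ->
  exists (P : 'M[C]_n) (q : 'I_n -> C), [/\ P \in unitmx, forall i, q i \is Num.real,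
    S *m S^t* = P *m P^t* & B = P *m diag_mx (\row_i q i) *m P^t*].
Proof.
move=> Su /hermP Bh; pose B' := invmx S *m B *m (invmx S)^t*.
have B'h : B' \is hermsymmx by apply/hermP; rewrite /B' !trmxCM trmxCK Bh mulmxA.
have [U [q [U1 U2 qr B'E]]] := herm_diagonalize B'h.
have SVC : (invmx S)^t* *m S^t* = 1%:M by rewrite -trmxCM mulmxV // trmx1 map_mx1.
exists (S *m U), q; split=> //.
- by rewrite unitmx_mul Su; case/mulmx1_unit: U1.
- by rewrite trmxCM mulmxA -[S *m U *m _]mulmxA U1 mulmx1.
rewrite trmxCM -!mulmxA [U *m (_ *m _)]mulmxA [U *m _ *m _]mulmxA -B'E /B'.
by rewrite !mulmxA mulmxV // mul1mx -mulmxA SVC mulmx1.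
Qed.

End hermitian_matrices.

Local Open Scope complex_scope.

(** * Scalar inequalities *)

Section scalar.
Context {R : realType}.
Implicit Types x y z s : R.

Lemma expR_ge_quad z : 0 <= z -> 1 + z + z ^+ 2 / 4 <= expR z.
Proof.
move=> z0; have -> : expR z = expR (z / 2) ^+ 2.
  by rewrite expr2 -expRD; congr expR; field.
have h := expR_ge1Dx (z / 2).
have -> : 1 + z + z ^+ 2 / 4 = (1 + z / 2) ^+ 2 by field.
by rewrite ler_pXn2r // nnegrE; [lra | exact: expR_ge0].
Qed.

Lemma ln_ge_1subV x : 0 < x -> 1 - x^-1 <= ln x.
Proof.
move=> x0; have := expR_ge1Dx (- ln x).
rewrite expRN lnK ?posrE // => h; lra.
Qed.

Lemma ln_le_sub1 x : 0 < x -> ln x <= x - 1.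
Proof.
move=> x0; have := expR_ge1Dx (ln x); rewrite lnK ?posrE // => h; lra.
Qed.

Lemma ln_prod (I : finType) (f : I -> R) : (forall i, 0 < f i) ->
  ln (\prod_i f i) = \sum_i ln (f i).
Proof.
move=> f0; suff [] : 0 < \prod_i f i /\ ln (\prod_i f i) = \sum_i ln (f i) by [].
apply: (big_ind2 (fun x y => 0 < x /\ ln x = y)); first by rewrite ln1.
  by move=> x1 x2 y1 y2 [x0 <-] [y0 <-]; rewrite mulr_gt0 // lnM.
by move=> i _; split.
Qed.

(** [x - 1 - ln x] dominates the squared relative step [(1 - 1/x)^2], up to a constant, except near
    0, where the square blows up faster than [- ln x]; there a constant lower bound takes over. *)
Lemma psi_ge x : 0 < x ->
  16^-1 <= x - 1 - ln x \/ (1 - x^-1) ^+ 2 / 16 <= x - 1 - ln x.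
Proof.
move=> x0; have [x1|x1] := leP 1 x.
  right; have z0 : 0 <= ln x by apply: ln_ge0.
  have := expR_ge_quad z0; rewrite lnK ?posrE // => h.
  have h1 := ln_ge_1subV x0.
  have h2 : 0 <= 1 - x^-1 by rewrite subr_ge0 invf_le1.
  have : (1 - x^-1) ^+ 2 <= ln x ^+ 2 by rewrite ler_pXn2r // nnegrE.
  nra.
(* Applying [ln t <= t - 1] to the square root produces the square [(1 - t)^2]. It is at least 1/16
   for [t <= 3/4]; above that threshold [1 + t <= 4 t^2]. *)
pose t := Num.sqrt x.
have t0 : 0 < t by rewrite sqrtr_gt0.
have xE : x = t ^+ 2 by rewrite sqr_sqrtr // ltW.
have t1 : t < 1 by rewrite -(ltr_pXn2r (n:=2)) ?nnegrE // ?ltW // -xE expr1n.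
have lx : ln x = 2 * ln t.
  by rewrite xE lnXn // mulr_natl.
have h := ln_le_sub1 t0.
have psi_t : (1 - t) ^+ 2 <= x - 1 - ln x by rewrite lx xE; nra.
have [th|th] := leP t (3 / 4).
  left; apply: le_trans psi_t; nra.
right; apply: le_trans psi_t.
have -> : (1 - x^-1) ^+ 2 / 16 = ((1 + t) / (4 * t ^+ 2)) ^+ 2 * (1 - t) ^+ 2.
  by rewrite xE; field; rewrite gt_eqF.
have q0 : 0 < 4 * t ^+ 2 by rewrite mulr_gt0 ?exprn_gt0.
have q1 : (1 + t) / (4 * t ^+ 2) <= 1 by rewrite ler_pdivrMr // mul1r; nra.
by rewrite ler_piMl ?sqr_ge0 // exprn_ile1 // divr_ge0 ?(ltW q0) //; lra.
Qed.

(* The constants 300 and 10 of the algorithm are used here: [300] is the weight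
   of the regulariser in [B], and [5 = 10 / 2]. *)
Lemma log_tradeoff (m B r2 : R) : 1 < m -> 0 < r2 ->
  300 * (m - 1 - ln m) <= B -> 16^-1 <= B \/ r2 / 16 <= B ->
  ln m <= B + 5 * ln (1 + (1 - m^-1) ^+ 2 / r2).
Proof.
move=> m1 r0 hB hr.
have m0 : 0 < m by lra.
set z := ln m; set u := 1 - m^-1; set sg := u ^+ 2 / r2.
have z0 : 0 < z by apply: ln_gt0.
have sg0 : 0 <= sg by rewrite divr_ge0 ?sqr_ge0 // ltW.
have lsg0 : 0 <= ln (1 + sg) by apply: ln_ge0; lra.
have hz : 75 * z ^+ 2 <= B.
  by have := expR_ge_quad (ltW z0); rewrite lnK ?posrE // -/z => h; rewrite -/z in hB; lra.
(* For [z >= 1/75] the quadratic bound alone gives [z <= 75 z^2 <= B]. *)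
have [zl|zl] := leP (75^-1) z; first by nra.
have sgV : sg / (1 + sg) <= ln (1 + sg).
  have -> : sg / (1 + sg) = 1 - (1 + sg)^-1 by field; apply: lt0r_neq0; lra.
  by apply: ln_ge_1subV; lra.
(* For [sg >= 1/300] the logarithmic term suffices: [5 / 301] exceeds [1 / 75]. *)
have [sl|sl] := leP (300^-1) sg.
  have h : 301^-1 <= sg / (1 + sg) by rewrite ler_pdivlMr; lra.
  nra.
have B0 : 0 <= B by nra.
case: hr => [hr|hr]; first by lra.
have h2 : 498 / 500 * sg <= sg / (1 + sg) by rewrite ler_pdivlMr; nra.
have uz : 75 / 76 * z <= u.
  have : m^-1 <= (1 + z)^-1.
    rewrite lef_pV2 ?posrE; [|lra|lra].
    by have := expR_ge1Dx z; rewrite lnK ?posrE.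
  have -> : (1 + z)^-1 = 1 - z / (1 + z) by field; apply: lt0r_neq0; lra.
  have : 75 / 76 * z <= z / (1 + z) by rewrite ler_pdivlMr; nra.
  rewrite /u; lra.
have u0 : 0 <= u by lra.
(* [498 / 100] is [5] times [498 / 500]. By AM-GM the right-hand side is at least
   [2 u sqrt (498 / 1600)], and [2 sqrt (498 / 1600) > 76 / 75]. *)
suff : 76 / 75 * u <= r2 / 16 + 498 / 100 * sg by lra.
rewrite /sg; clearbody u; clear sg sg0 lsg0 sgV sl h2.
have -> : r2 / 16 + 498 / 100 * (u ^+ 2 / r2)
   = (r2 ^+ 2 / 16 + 498 / 100 * u ^+ 2) / r2.
  by field; rewrite gt_eqF.
rewrite ler_pdivlMr //.
have := sqr_ge0 (r2 / 4 - 2 * u); nra.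
Qed.

(** One-sided derivative at [s = 0] with an explicit remainder: for [s <= 1/2] one has
    [1 + s * eta >= 1/2], hence [ln (1 + s * eta) >= s * eta - 2 (s * eta)^2]. *)
Lemma first_order_condition (I : finType) (w eta : I -> R) (c : R) :
  (forall k, 0 <= w k) -> (forall k, 0 < 1 + eta k) ->
  (forall s, 0 < s < 1 -> 0 <= - (\sum_k w k * ln (1 + s * eta k)) + s * c) ->
  \sum_k w k * eta k <= c.
Proof.
move=> w0 e0 H.
pose D := \sum_k w k * (2 * eta k ^+ 2).
have D0 : 0 <= D by apply: sumr_ge0 => k _; have := w0 k; have := sqr_ge0 (eta k); nra.
have key s : 0 < s <= 2^-1 -> \sum_k w k * eta k <= c + s * D.
  move=> /andP[s0 s1]; have := H s.
  rewrite s0 /= => /(_ ltac:(lra)) h.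
  rewrite -(ler_pM2l s0) mulrDr.
  apply: (@le_trans _ _ (\sum_k w k * ln (1 + s * eta k) + s * (s * D))); last lra.
  rewrite /D !mulr_sumr -big_split /=; apply: ler_sum => k _.
  have hk := e0 k.
  have pk : 2^-1 <= 1 + s * eta k by nra.
  have h1 : 1 - (1 + s * eta k)^-1 <= ln (1 + s * eta k) by apply: ln_ge_1subV; lra.
  have h2 : (1 + s * eta k)^-1 <= 1 - s * eta k + 2 * (s * eta k) ^+ 2.
    rewrite -div1r ler_pdivrMr; last lra.
    have := sqr_ge0 (s * eta k); nra.
  have := w0 k; nra.
apply/ler_addgt0Pr => e epos.
(* This [s] keeps the remainder [s * D] below [e]; the denominator is [1 + D] because [D] may
   vanish. *)
have := key (Num.min 2^-1 (e / (1 + D))).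
set s := Num.min _ _.
have s0 : 0 < s by rewrite lt_min divr_gt0 /=; lra.
have s1 : s <= 2^-1 by rewrite ge_min lexx.
have s2 : s <= e / (1 + D) by rewrite ge_min lexx orbT.
rewrite s0 s1 => /(_ isT) h; apply: (le_trans h); rewrite lerD2l.
move: s2; rewrite ler_pdivlMr; nra.
Qed.

Lemma expR_convex p q s : 0 <= s <= 1 ->
  expR ((1 - s) * p + s * q) <= (1 - s) * expR p + s * expR q.
Proof.
move=> /andP[s0 s1]; set m := (1 - s) * p + s * q.
have tangent v : expR m * (1 + (v - m)) <= expR v.
  have -> : expR v = expR m * expR (v - m) by rewrite -expRD addrC subrK.
  by rewrite ler_pM2l ?expR_gt0 // expR_ge1Dx.
have -> : expR m = (1 - s) * (expR m * (1 + (p - m))) + s * (expR m * (1 + (q - m))).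
  by rewrite /m; ring.
by apply: lerD; apply: ler_wpM2l => //; rewrite subr_ge0.
Qed.

Lemma sum_expR_convex (I : finType) (c th0 th1 : I -> R) s :
  (forall k, 0 <= c k) -> 0 <= s <= 1 ->
  \sum_k c k * expR (th0 k) = 1 -> \sum_k c k * expR (th1 k) = 1 ->
  \sum_k c k * expR ((1 - s) * th0 k + s * th1 k) <= 1.
Proof.
move=> c0 s01 E0 E1.
apply: (@le_trans _ _ ((1 - s) * 1 + s * 1)); last by rewrite !mulr1 subrK.
rewrite -[X in (1 - s) * X]E0 -[X in s * X]E1 !mulr_sumr -big_split /=.
apply: ler_sum => k _.
apply: le_trans (ler_wpM2l (c0 k) (expR_convex (th0 k) (th1 k) s01)) _.
by rewrite mulrDr (mulrCA (c k) (1 - s)) (mulrCA (c k) s).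
Qed.

Lemma sum_expR_normalize (I : finType) (c th : I -> R) :
  0 < \sum_k c k * expR (th k) ->
  \sum_k c k * expR (th k - ln (\sum_k c k * expR (th k))) = 1.
Proof.
move=> S0; under eq_bigr do rewrite expRD expRN lnK ?posrE // mulrA.
by rewrite -mulr_suml divff // gt_eqF.
Qed.

(** Convexity of log-sum-exp. Shifting the exponents by the two logarithms normalises both end sums
    to 1, after which termwise convexity of [expR] is enough. *)
Lemma ln_sum_expR_convex (I : finType) (c th0 th1 : I -> R) s :
  (forall k, 0 <= c k) -> 0 <= s <= 1 ->
  0 < \sum_k c k * expR (th0 k) -> 0 < \sum_k c k * expR (th1 k) ->
  0 < \sum_k c k * expR ((1 - s) * th0 k + s * th1 k) ->
  ln (\sum_k c k * expR ((1 - s) * th0 k + s * th1 k)) <=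
  (1 - s) * ln (\sum_k c k * expR (th0 k)) + s * ln (\sum_k c k * expR (th1 k)).
Proof.
move=> c0 s01 S00 S10 Ss0.
have := sum_expR_convex c0 s01 (sum_expR_normalize S00) (sum_expR_normalize S10).
move: (ln (\sum_k c k * expR (th0 k))) (ln (\sum_k c k * expR (th1 k))) => l0 l1.
move=> h; rewrite -[leRHS]expRK ler_ln ?posrE ?expR_gt0 //.
rewrite -(ler_pM2l (expR_gt0 (- ((1 - s) * l0 + s * l1)))) -expRD addNr expR0.
apply: le_trans h; rewrite mulr_sumr; apply: ler_sum => k _.
rewrite mulrCA -expRD; apply: ler_wpM2l => //.
by rewrite ler_expR le_eqVlt; apply/orP; left; apply/eqP; ring.
Qed.
End scalar.

(** * Real traces, determinants and eigenvalues of Hermitian matrices over [R[i]] *)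

Section complex_matrices.
Context {R : realType}.
Local Notation C := R[i].

Lemma conjC_RtoC (x : R) : (x%:C)^*%R = x%:C.
Proof. by apply/CrealP; rewrite complex_real. Qed.

Lemma RtoC_Re (z : C) : z \is Num.real -> (complex.Re z)%:C = z.
Proof. exact: RRe_real. Qed.

Lemma ReD (x y : C) : complex.Re (x + y) = complex.Re x + complex.Re y.
Proof. by case: x => ? ?; case: y. Qed.

Lemma Re_sum (I : finType) (F : I -> C) :
  complex.Re (\sum_i F i) = \sum_i complex.Re (F i).
Proof. by apply: (big_morph _ ReD). Qed.

Lemma ReZ (x : R) (z : C) : complex.Re (x%:C * z) = x * complex.Re z.
Proof. by case: z => a b /=; rewrite mul0r subr0. Qed.

Lemma Re_gt0 (z : C) : 0 < z -> 0 < complex.Re z.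
Proof. by rewrite ltcE => /andP[]. Qed.

Lemma herm_tr_real n (A B : 'M[C]_n) : A \is hermsymmx -> B \is hermsymmx ->
  \tr (A *m B) \is Num.real.
Proof.
move=> /hermP Ah /hermP Bh; apply/CrealP.
by rewrite -trace_map_mx -mxtrace_tr map_trmx trmxCM Ah Bh mxtrace_mulC.
Qed.

Lemma Re_tr_herm n (X Y : 'M[C]_n) : X \is hermsymmx -> Y \is hermsymmx ->
  (complex.Re (\tr (X *m Y)))%:C = \tr (X *m Y).
Proof. by move=> Xh Yh; move: (herm_tr_real Xh Yh); move: (\tr _) => z; exact: RtoC_Re. Qed.

Definition rdiag n (q : 'I_n -> R) : 'M[C]_n := diag_mx (\row_i (q i)%:C).

Lemma rdiag_conj n (q : 'I_n -> R) : (rdiag q)^t* = rdiag q.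
Proof.
rewrite /rdiag tr_diag_mx map_diag_mx; congr diag_mx.
apply/rowP => i; rewrite !mxE; exact: conjC_RtoC.
Qed.

Lemma rdiag_herm n (S : 'M[C]_n) q : S *m rdiag q *m S^t* \is hermsymmx.
Proof. by apply/hermP; rewrite !trmxCM trmxCK rdiag_conj mulmxA. Qed.

(** Positive definiteness stated as a factorisation, since the factor [S] is what the congruence
    arguments work with. *)
Definition posdefmx n (M : 'M[C]_n) := exists2 S, S \in unitmx & M = S *m S^t*.

Lemma sqr_herm n (S : 'M[C]_n) : S *m S^t* \is hermsymmx.
Proof. by apply/hermP; rewrite trmxCM trmxCK. Qed.

Lemma posdef_herm n (M : 'M[C]_n) : posdefmx M -> M \is hermsymmx.
Proof. by case=> S _ ->; exact: sqr_herm. Qed.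

Lemma sqr_psd n (S : 'M[C]_n) : psd (S *m S^t*).
Proof.
split; first exact: sqr_herm.
move=> v; have -> : v^t* *m (S *m S^t*) *m v = (S^t* *m v)^t* *m (S^t* *m v).
  by rewrite trmxCM trmxCK !mulmxA.
rewrite mxE sumr_ge0 // => i _.
by rewrite trmxCE mulrC -normCK exprn_ge0.
Qed.

Lemma posdef_rdiag n (S : 'M[C]_n) (q : 'I_n -> R) :
  S \in unitmx -> (forall i, 0 < q i) -> posdefmx (S *m rdiag q *m S^t*).
Proof.
move=> Su q0; exists (S *m rdiag (fun i => Num.sqrt (q i))).
  rewrite unitmx_mul Su unitmxE det_diag unitfE; apply/prodf_neq0 => i _.
  by rewrite mxE gt_eqF // ltcR sqrtr_gt0.
rewrite trmxCM rdiag_conj !mulmxA; congr (_ *m _); rewrite -!mulmxA; congr (_ *m _).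
rewrite mulmx_diag; congr diag_mx; apply/rowP => i.
by rewrite !mxE -rmorphM /= -expr2 sqr_sqrtr // ltW.
Qed.

Lemma real_simultaneous_diagonalization n (M B : 'M[C]_n) :
  posdefmx M -> B \is hermsymmx ->
  exists (S : 'M[C]_n) (q : 'I_n -> R),
    [/\ S \in unitmx, M = S *m S^t* & B = S *m rdiag q *m S^t*].
Proof.
move=> [S0 S0u ->] Bh.
have [S [q [Su qr SE BE]]] := simultaneous_diagonalization S0u Bh.
exists S, (fun i => complex.Re (q i)); split; [exact: Su|exact: SE|].
rewrite BE; congr (_ *m diag_mx _ *m _); apply/rowP => i.
by rewrite !mxE RtoC_Re.
Qed.

Lemma rdiag1 n : rdiag (fun=> 1) = 1%:M :> 'M[C]_n.
Proof. by rewrite /rdiag -diag_const_mx; congr diag_mx; apply/rowP => i; rewrite !mxE. Qed.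

Lemma rdiag_affine n (S : 'M[C]_n) (p q : 'I_n -> R) (a b : R) :
  a%:C *: (S *m rdiag p *m S^t*) + b%:C *: (S *m rdiag q *m S^t*) =
  S *m rdiag (fun i => a * p i + b * q i) *m S^t*.
Proof.
have -> : rdiag (fun i => a * p i + b * q i) = a%:C *: rdiag p + b%:C *: rdiag q.
  apply/matrixP => i j; rewrite !mxE; case: eqP => _; rewrite !(mulr1n, mulr0n).
    by rewrite rmorphD !rmorphM.
  by rewrite !mulr0 addr0.
by rewrite mulmxDr mulmxDl -!scalemxAr -!scalemxAl.
Qed.

Lemma Re_det_rdiag n (S : 'M[C]_n) (q : 'I_n -> R) :
  complex.Re (\det (S *m rdiag q *m S^t*)) =
  complex.Re (`|\det S| ^+ 2) * \prod_i q i.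
Proof.
rewrite !det_mulmx det_diag.
have -> : \det (S^t*) = (\det S)^*%R by rewrite det_map_mx det_tr.
have -> : \prod_i (\row_i0 (q i0)%:C) 0 i = (\prod_i q i)%:C.
  by rewrite rmorph_prod; apply: eq_bigr => i _; rewrite mxE.
by rewrite mulrAC -normCK mulrC ReZ mulrC.
Qed.

Lemma Re_normdet_gt0 n (S : 'M[C]_n) : S \in unitmx -> 0 < complex.Re (`|\det S| ^+ 2).
Proof.
by rewrite unitmxE unitfE => h; apply: Re_gt0; rewrite exprn_gt0 // normr_gt0.
Qed.

Lemma posdef_det_gt0 n (M : 'M[C]_n) : posdefmx M -> 0 < complex.Re (\det M).
Proof.
move=> [S Su ->]; have := Re_det_rdiag S (fun=> 1).
by rewrite rdiag1 mulmx1 => ->; rewrite mulr_gt0 ?Re_normdet_gt0 ?prodr_gt0.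
Qed.

Lemma posdef_tr_gt0 n (A M : 'M[C]_n) : psd A -> A != 0 -> posdefmx M ->
  0 < complex.Re (\tr (A *m M)).
Proof. by move=> Ap A0 [S Su ->]; apply/Re_gt0/psdmx_tr_mul_gt0. Qed.

Lemma psd_posdef n (M : 'M[C]_n) : psd M -> 0 < complex.Re (\det M) -> posdefmx M.
Proof.
move=> Mp d0; have [|S Su ->] := psdmx_sqr Mp; last by exists S.
by apply: contraTneq d0 => ->; rewrite ltxx.
Qed.

End complex_matrices.

(** * The Hessian of the regularised loss *)

Section derivatives.
Context {R : realType}.
Variable K : finType.
Implicit Types (a b w : K -> R) (x c : R).

Lemma is_derive_bigsum (f : K -> R -> R) (df : K -> R) x :
  (forall k, is_derive x (1 : R) (f k) (df k)) ->
  is_derive x (1 : R) (fun r => \sum_k f k r) (\sum_k df k).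
Proof.
move=> fd; rewrite -fct_sumE.
apply: (big_ind2 (fun g dg => is_derive x 1 g dg)) => //.
- exact: is_derive_cst.
- by move=> g1 dg1 g2 dg2; exact: is_deriveD.
Qed.

Lemma is_derive_affine (p q x : R) : is_derive x (1 : R) (fun r => p + r * q) q.
Proof.
have -> : (fun r => p + r * q) = (cst p + (q \*: id) : R -> R).
  by apply/funext => r /=; rewrite -[(_ + _) r]/(p + q *: r) /GRing.scale /= mulrC.
have d := is_deriveD (is_derive_cst p x 1) (is_deriveZ q (is_derive_id x (1 : R))).
by apply: (is_derive_eq d); rewrite add0r /GRing.scale /= mulr1.
Qed.

Lemma is_derive_ln_affine (p q : R) : 0 < p -> is_derive (0 : R) (1 : R) (fun r => ln (p + r * q)) (q / p).
Proof.
move=> p0; have d1 := is_derive_affine p q 0.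
have d2 : is_derive ((fun r => p + r * q) 0) (1 : R) (@ln R) p^-1.
  by rewrite mul0r addr0; exact: is_derive1_ln.
by have := @is_derive1_comp R (@ln R) (fun r => p + r * q) 0 _ _ d2 d1; rewrite mulrC.
Qed.

Lemma is_derive_inv_affine (p q : R) : p != 0 ->
  is_derive (0 : R) (1 : R) (fun r => (p + r * q)^-1) (- (q / p ^+ 2)).
Proof.
move=> p0; have d1 := is_derive_affine p q 0.
have h : (fun r => p + r * q) 0 != 0 by rewrite mul0r addr0.
have d2 := @is_deriveV R (fun r => p + r * q) 0 _ 1 h d1.
by apply: (is_derive_eq d2); rewrite mul0r addr0 /GRing.scale /= mulNr mulrC.
Qed.

Lemma derive1_sum_ln c w a b : (forall k, 0 < a k) ->
  derive1 (fun r => c - \sum_k w k * ln (a k + r * b k)) 0 = - \sum_k w k * (b k / a k).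
Proof.
move=> a0; rewrite derive1E.
have d1 : is_derive (0 : R) (1 : R) (fun r => \sum_k w k * ln (a k + r * b k)) (\sum_k w k * (b k / a k)).
  apply: is_derive_bigsum => k.
  exact: (is_deriveZ (w k) (is_derive_ln_affine (b k) (a0 k))).
have d2 := is_deriveB (is_derive_cst c (0 : R) 1) d1.
by have := @derive_val _ _ _ _ _ _ _ d2; rewrite sub0r.
Qed.

Lemma derive1_sum_inv w a b : (forall k, 0 < a k) ->
  derive1 (fun r => - \sum_k w k / (a k + r * b k)) 0 = \sum_k w k * (b k / a k ^+ 2).
Proof.
move=> a0; rewrite derive1E.
have d1 : is_derive (0 : R) (1 : R) (fun r => \sum_k w k / (a k + r * b k))
    (\sum_k w k * (- (b k / a k ^+ 2))).
  apply: is_derive_bigsum => k.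
  exact: (is_deriveZ (w k) (is_derive_inv_affine (b k) (lt0r_neq0 (a0 k)))).
have d2 := is_deriveN d1.
have := @derive_val _ _ _ _ _ _ _ d2 => ->.
by rewrite -sumrN; apply: eq_bigr => k _; rewrite mulrN opprK.
Qed.

(** Small perturbations stay where [Lt] is finite, so an explicit formula may replace [fine] near 0
    before differentiating. *)
Lemma near0_affine_gt0 a b : (forall k, 0 < a k) ->
  \forall r \near (0 : R), forall k, 0 < a k + r * b k.
Proof.
move=> a0.
have := @filter_forall R K (fun k => [set r | 0 < a k + r * b k]) (nbhs (0 : R)) _.
apply => k.
have e0 : 0 < a k / (1 + `|b k|) by rewrite divr_gt0 // ltr_pwDl.
apply: filterS (nbhs0_lt e0) => r.
rewrite ltr_pdivlMr ?ltr_pwDl // => h.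
have h2 : - (r * b k) <= `|r| * `|b k| by rewrite -normrM -normrN ler_norm.
move: h; rewrite mulrDr mulr1 /= => h; have h3 := normr_ge0 r; lra.
Qed.

Lemma eq_derive1 (f g : R -> R) : (\forall r \near (0 : R), f r = g r) ->
  derive1 f 0 = derive1 g 0.
Proof. by move=> h; rewrite !derive1E; exact: near_eq_derive. Qed.

End derivatives.

Section hessian_formula.
Context {R : realType} {d : nat}.
Local Notation C := R[i].
Implicit Types (S M N U V : 'M[C]_d) (q : 'I_d -> R).

Lemma vec_dot V U : ((vec V)^t* *m vec U) 0 0 = \tr (V^t* *m U).
Proof.
rewrite mxE (reindex (uncurry (@mxvec_index d d))) /=; last exact: curry_mxvec_bij.
transitivity (\sum_(p : 'I_d * 'I_d) (V p.2 p.1)^*%R * U p.2 p.1).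
  by apply: eq_bigr => -[i j] _ /=; rewrite !trmxCE /vec ![_^T (mxvec_index i j) 0]mxE !mxvecE !mxE.
rewrite -(pair_bigA _ (fun i j => (V j i)^*%R * U j i)) /=.
by apply: eq_bigr => i _; rewrite mxE; apply: eq_bigr => j _; rewrite trmxCE.
Qed.

Lemma vecD U V : vec (U + V) = vec U + vec V.
Proof. by rewrite /vec !linearD. Qed.

Lemma vecZ (a : C) U : vec (a *: U) = a *: vec U.
Proof. by rewrite /vec !linearZ. Qed.

Lemma vec_surj (x : 'cV[C]_(d * d)) : exists U, x = vec U.
Proof. by exists (vec_mx x^T)^T; rewrite /vec trmxK vec_mxK trmxK. Qed.

Lemma vec_form_inj (G H : 'M[C]_(d * d)) :
  (forall U V : 'M[C]_d, ((vec V)^t* *m (G *m vec U)) 0 0 = ((vec V)^t* *m (H *m vec U)) 0 0) ->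
  G = H.
Proof.
move=> GH; apply/matrixP => i j.
have [V VE] := vec_surj (delta_mx i 0 : 'cV[C]_(d * d)); have [U UE] := vec_surj (delta_mx j 0 : 'cV[C]_(d * d)).
have := GH U V; rewrite -VE -UE -!colE trmx_delta map_delta_mx -!rowE !mxE.
by [].
Qed.

Lemma herm_decomposition M : exists H1 H2 : 'M[C]_d,
  [/\ H1 \is hermsymmx, H2 \is hermsymmx & M = H1 + 'i%R *: H2].
Proof.
have n2 : (2 : C) != 0 by rewrite pnatr_eq0.
exists (2^-1 *: (M + M^t*)), (2^-1 *: ('i%R *: (M^t* - M))); split.
- apply/hermP/matrixP => i j; rewrite !mxE rmorphM rmorphD /= conjCK.
  by rewrite fmorphV rmorph_nat addrC.
- apply/hermP/matrixP => i j; rewrite !mxE !rmorphM rmorphB /= conjCK conjCi.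
  by rewrite fmorphV rmorph_nat mulNr -mulrN opprB.
apply/matrixP => i j; rewrite !mxE.
have iE (x : C) : 'i%R * (2^-1 * ('i%R * x)) = - (2^-1 * x).
  by rewrite mulrCA (mulrA 'i%R) -expr2 sqrCi mulN1r mulrN.
by rewrite iE; field.
Qed.

(** Two candidates agree on Hermitian pairs; decomposing [U], then [V], as [H1 + i H2] extends the
    agreement to all matrices. *)
Lemma hessian_unique (phi : 'M[C]_d -> R) M (G : 'M[C]_(d * d)) :
  is_hessian phi M G -> hessian phi M = G.
Proof.
move=> HG; apply: xget_unique => //= G' HG'; apply/eqP; rewrite -subr_eq0; apply/eqP.
set D := G' - G.
have D0 U V : U \is hermsymmx -> V \is hermsymmx -> (vec V)^t* *m (D *m vec U) = 0.
  move=> Uh Vh; apply/matrixP => i j; rewrite !ord1 mulmxBl mulmxBr.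
  by rewrite mxE [X in _ + X]mxE -HG // -HG' // subrr mxE.
have D1 U V : V \is hermsymmx -> (vec V)^t* *m (D *m vec U) = 0.
  move=> Vh; have [H1 [H2 [h1 h2 ->]]] := herm_decomposition U.
  rewrite vecD vecZ !mulmxDr -!scalemxAr D0 // D0 // scaler0 addr0 //.
have D2 U V : (vec V)^t* *m (D *m vec U) = 0.
  have [H1 [H2 [h1 h2 ->]]] := herm_decomposition V.
  rewrite vecD vecZ linearD linearZ /= map_mxD map_mxZ mulmxDl -scalemxAl.
  by rewrite D1 // D1 // scaler0 addr0.
by apply: vec_form_inj => U V; rewrite D2 mul0mx mulmx0.
Qed.

Variables (lam : R) (A : nat -> 'M[C]_d) (t : nat).
Hypothesis A_psd : forall tau, (1 <= tau <= t)%N -> psd (A tau) /\ A tau != 0.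

Let Apsd (i : 'I_t) : psd (A i.+1).
Proof. by case: (@A_psd i.+1) => //=; rewrite ltn_ord. Qed.

Let Aneq0 (i : 'I_t) : A i.+1 != 0.
Proof. by case: (@A_psd i.+1) => //=; rewrite ltn_ord. Qed.

Lemma loss_fin (B M : 'M[C]_d) : 0 < complex.Re (\tr (B *m M)) ->
  loss B M = (- ln (complex.Re (\tr (B *m M))))%:E.
Proof. by move=> h; rewrite /loss /= leNgt h. Qed.

Lemma logdet_reg_fin M : 0 < complex.Re (\det M) ->
  logdet_reg M = (- ln (complex.Re (\det M)))%:E.
Proof. by move=> h; rewrite /logdet_reg /= leNgt h. Qed.

Definition Lreal M : R :=
  - (\sum_(i < t) ln (complex.Re (\tr (A i.+1 *m M)))) - lam * ln (complex.Re (\det M)).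

Lemma Lt_posdef M : posdefmx M -> Lt lam A t M = (Lreal M)%:E.
Proof.
move=> Mp; rewrite /Lt logdet_reg_fin ?posdef_det_gt0 // big_add1 big_mkord.
rewrite (eq_bigr (fun i : 'I_t => (- ln (complex.Re (\tr (A i.+1 *m M))))%:E)) => [|i _].
  by rewrite sumEFin -EFinM -EFinD sumrN mulrN.
by rewrite loss_fin // posdef_tr_gt0.
Qed.

Lemma mulmx_inv_rdiag S q U : S \in unitmx -> (forall i, q i != 0) ->
  invmx (S *m rdiag q *m S^t*) *m U =
  invmx (S^t*) *m (rdiag (fun i => (q i)^-1) *m (invmx S *m U *m invmx (S^t*))) *m S^t*.
Proof.
move=> Su q0; set D := rdiag q; set D' := rdiag _.
have DD' : D *m D' = 1%:M.
  rewrite mulmx_diag -rdiag1; congr diag_mx; apply/rowP => i; rewrite !mxE -rmorphM /=.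
  by rewrite divff.
have Stu : S^t* \in unitmx by rewrite unitmx_trmxC.
have Mu : S *m D *m S^t* \in unitmx.
  by rewrite !unitmx_mul Su Stu andbT /=; case/mulmx1_unit: DD'.
set X := (RHS); suff -> : U = (S *m D *m S^t*) *m X by rewrite mulKmx.
by rewrite /X !mulmxA mulmxK // -[S *m D *m D']mulmxA DD' mulmx1 mulmxV // mul1mx mulmxKV.
Qed.

Lemma tr_inv_mul S q U V : S \in unitmx -> (forall i, q i != 0) ->
  \tr (invmx (S *m rdiag q *m S^t*) *m V *m (invmx (S *m rdiag q *m S^t*) *m U)) =
  \tr (rdiag (fun i => (q i)^-1) *m (invmx S *m V *m invmx (S^t*)) *m
      (rdiag (fun i => (q i)^-1) *m (invmx S *m U *m invmx (S^t*)))).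
Proof.
move=> Su q0; rewrite !(mulmx_inv_rdiag _ Su q0).
have Stu : S^t* \in unitmx by rewrite unitmx_trmxC.
move: (_ *m (invmx S *m V *m _)) (_ *m (invmx S *m U *m _)) => X Y.
by rewrite mxtrace_mulC !mulmxA mulmxK // mxtrace_mulC !mulmxA mulmxV // mul1mx mxtrace_mulC.
Qed.

Lemma tr_rdiag_mul q U : \tr (rdiag q *m U) = \sum_i (q i)%:C * U i i.
Proof.
by apply: eq_bigr => i _; rewrite mul_diag_mx !mxE.
Qed.

Lemma Re_tr_affine (B M U : 'M[C]_d) (r : R) :
  complex.Re (\tr (B *m (M + r%:C *: U))) =
  complex.Re (\tr (B *m M)) + r * complex.Re (\tr (B *m U)).
Proof. by rewrite mulmxDr -scalemxAr linearD linearZ /= ReD ReZ. Qed.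

Lemma sqr_rdiag_affine S q (r : R) :
  S *m S^t* + r%:C *: (S *m rdiag q *m S^t*) = S *m rdiag (fun i => 1 + r * q i) *m S^t*.
Proof.
rewrite -[S *m S^t*]scale1r -{1}[S]mulmx1 -rdiag1 rdiag_affine.
by under eq_fun do rewrite mul1r.
Qed.

(** Diagonalising [N] and [U] simultaneously turns the log-determinant on the line into a sum of
    [ln (1 + r * e i)], of the same shape as the losses; hence the joint index type
    ['I_t + 'I_d]. *)
Lemma gradient_Lreal N U : posdefmx N -> U \is hermsymmx ->
  derive1 (fun r : R => fine (Lt lam A t (N + r%:C *: U))) 0 =
  - (\sum_(i < t) complex.Re (\tr (A i.+1 *m U)) / complex.Re (\tr (A i.+1 *m N)))
  - lam * complex.Re (\tr (invmx N *m U)).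
Proof.
move=> Np Uh; have [S [e [Su NE UE]]] := real_simultaneous_diagonalization Np Uh.
pose w (k : 'I_t + 'I_d) := if k is inr _ then lam else 1.
pose a (k : 'I_t + 'I_d) := if k is inl i then complex.Re (\tr (A i.+1 *m N)) else 1.
pose b (k : 'I_t + 'I_d) := match k with
  | inl i => complex.Re (\tr (A i.+1 *m U)) | inr i => e i end.
have a0 k : 0 < a k by case: k => //= i; exact: posdef_tr_gt0.
pose c := - lam * ln (complex.Re (`|\det S| ^+ 2)).
transitivity (derive1 (fun r => c - \sum_k w k * ln (a k + r * b k)) 0).
  apply: eq_derive1; have := near0_affine_gt0 b a0.
  apply: filterS => r rp.
  have ME : N + r%:C *: U = S *m rdiag (fun i => 1 + r * e i) *m S^t*.
    by rewrite NE UE sqr_rdiag_affine.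
  have ep i : 0 < 1 + r * e i := rp (inr i).
  rewrite Lt_posdef; last by rewrite ME; exact: posdef_rdiag.
  rewrite /= /Lreal {2}ME Re_det_rdiag lnM ?posrE ?Re_normdet_gt0 ?prodr_gt0 //.
  rewrite ln_prod // big_sumType /= /c mulrDr opprD mulNr addrCA; congr (_ + _).
  rewrite opprD mulr_sumr; congr (- _ + _).
  by apply: eq_bigr => i _; rewrite Re_tr_affine mul1r.
rewrite derive1_sum_ln // big_sumType /= opprD; congr (- _ - _).
  by apply: eq_bigr => i _; rewrite mul1r.
rewrite -mulr_sumr; congr (_ * _).
have NE1 : N = S *m rdiag (fun=> 1) *m S^t* by rewrite rdiag1 mulmx1.
rewrite NE1 mulmx_inv_rdiag //.
rewrite mxtrace_mulC mulmxA mulmxV ?unitmx_trmxC // mul1mx.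
have -> : rdiag (fun=> 1^-1) = 1%:M :> 'M[C]_d by under eq_fun do rewrite invr1; exact: rdiag1.
rewrite mul1mx UE !mulmxA mulVmx // mul1mx mulmxK ?unitmx_trmxC // mxtrace_diag Re_sum.
by apply: eq_bigr => i _; rewrite mxE divr1.
Qed.

(** Here [M] and the outer direction [V] are diagonalised, so that [M + s V] stays diagonal in the
    same coordinates and the inverse in the gradient is explicit. [U] contributes only through the
    diagonal of its transform [Uh']. *)
Lemma D2_Lreal M U V : posdefmx M -> U \is hermsymmx -> V \is hermsymmx ->
  D2 (fun N => fine (Lt lam A t N)) M V U =
  \sum_(i < t) complex.Re (\tr (A i.+1 *m U)) * complex.Re (\tr (A i.+1 *m V))
     / complex.Re (\tr (A i.+1 *m M)) ^+ 2
  + lam * complex.Re (\tr (invmx M *m V *m (invmx M *m U))).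
Proof.
move=> Mp Uh Vh; have [S [e [Su ME VE]]] := real_simultaneous_diagonalization Mp Vh.
pose Uh' := invmx S *m U *m invmx (S^t*).
pose w (k : 'I_t + 'I_d) := match k with
  | inl i => complex.Re (\tr (A i.+1 *m U)) | inr i => lam * complex.Re (Uh' i i) end.
pose a (k : 'I_t + 'I_d) := if k is inl i then complex.Re (\tr (A i.+1 *m M)) else 1.
pose b (k : 'I_t + 'I_d) := match k with
  | inl i => complex.Re (\tr (A i.+1 *m V)) | inr i => e i end.
have a0 k : 0 < a k by case: k => //= i; exact: posdef_tr_gt0.
have Stu : S^t* \in unitmx by rewrite unitmx_trmxC.
rewrite /D2; transitivity (derive1 (fun r => - \sum_k w k / (a k + r * b k)) 0).
  apply: eq_derive1; have := near0_affine_gt0 b a0.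
  apply: filterS => s sp.
  have MsE : M + s%:C *: V = S *m rdiag (fun i => 1 + s * e i) *m S^t*.
    by rewrite ME VE sqr_rdiag_affine.
  have ep i : 0 < 1 + s * e i := sp (inr i).
  rewrite gradient_Lreal //; last by rewrite MsE; exact: posdef_rdiag.
  rewrite big_sumType /= opprD; congr (- _ - _).
    by apply: eq_bigr => i _; rewrite Re_tr_affine.
  rewrite MsE mulmx_inv_rdiag // => [|i]; last exact: lt0r_neq0.
  rewrite mxtrace_mulC mulmxA mulmxV // mul1mx tr_rdiag_mul Re_sum mulr_sumr.
  by apply: eq_bigr => i _; rewrite ReZ mulrCA mulrC.
rewrite derive1_sum_inv // big_sumType /=; congr (_ + _).
  by apply: eq_bigr => i _; rewrite mulrA.
have ME1 : M = S *m rdiag (fun=> 1) *m S^t* by rewrite rdiag1 mulmx1.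
have V'E : invmx S *m V *m invmx (S^t*) = rdiag e.
  by rewrite VE !mulmxA mulVmx // mul1mx mulmxK.
rewrite ME1 tr_inv_mul // V'E -/Uh'.
have -> : rdiag (fun=> 1^-1) = 1%:M :> 'M[C]_d by under eq_fun do rewrite invr1; exact: rdiag1.
rewrite !mul1mx tr_rdiag_mul Re_sum mulr_sumr; apply: eq_bigr => i _.
by rewrite ReZ expr1n divr1 mulrAC mulrA.
Qed.

End hessian_formula.

(** * Determinants of weighted sums of rank-one matrices *)

Section rank_one_sums.
Context {R : realType} {d : nat}.
Local Notation C := R[i].
Variable K : finType.
Implicit Types (b : K -> 'M[C]_d) (w : K -> R) (U V : 'M[C]_d).

(** Vectors and weights are kept apart because only the weights move along a segment. *)
Definition gram b w : 'M[C]_(d * d) :=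
  \sum_k (w k)%:C *: (vec (b k) *m (vec (b k))^t*).

Lemma gram_form b w U V : ((vec V)^t* *m (gram b w *m vec U)) 0 0 =
  \sum_k (w k)%:C * (\tr (V^t* *m b k) * \tr ((b k)^t* *m U)).
Proof.
rewrite /gram mulmx_suml mulmx_sumr summxE; apply: eq_bigr => k _.
rewrite -scalemxAl -scalemxAr mxE; congr (_ * _).
by rewrite -!vec_dot !mulmxA -mulmxA mxE big_ord1.
Qed.

Lemma gram_herm b w : gram b w \is hermsymmx.
Proof.
apply/hermP; rewrite /gram linear_sum raddf_sum /=; apply: eq_bigr => k _.
rewrite linearZ /= map_mxZ; congr (_ *: _); first exact: conjC_RtoC.
by rewrite trmxCM trmxCK.
Qed.

Lemma gram_psd b w : (forall k, 0 <= w k) -> psdmx (gram b w).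
Proof.
move=> w0; split; first exact: gram_herm.
move=> v; have [V ->] := vec_surj v; rewrite -mulmxA gram_form.
apply: sumr_ge0 => k _; apply: mulr_ge0; first by rewrite lecR.
have -> : \tr (V^t* *m b k) = (\tr ((b k)^t* *m V))^*%R.
  by rewrite -trace_trmxC trmxCM trmxCK.
by rewrite mulrC -normCK exprn_ge0.
Qed.

Lemma gram_det b : exists2 c : {ffun 'I_(d * d) -> K} -> R, (forall f, 0 <= c f) &
  forall w, complex.Re (\det (gram b w)) = \sum_f c f * \prod_i w (f i).
Proof.
have [c c0 cE] := det_weighted_sum (fun k => vec (b k)).
exists (fun f => complex.Re (c f)) => [f|w]; first by have := c0 f; rewrite lecE => /andP[].
rewrite /gram (cE (fun k => (w k)%:C)) Re_sum; apply: eq_bigr => f _.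
by rewrite -rmorph_prod mulrC ReZ mulrC.
Qed.

(** The Cauchy-Binet coefficients are nonnegative, so no appeal to the Loewner order is made. *)
Lemma gram_det_mono b w w' : (forall k, 0 <= w k <= w' k) ->
  complex.Re (\det (gram b w)) <= complex.Re (\det (gram b w')).
Proof.
move=> ww'; have [c c0 cE] := gram_det b; rewrite !cE; apply: ler_sum => f _.
by apply: ler_wpM2l => //; apply: ler_prod.
Qed.

Lemma gram_det_log_convex b (w0 w1 ws : K -> R) s : 0 <= s <= 1 ->
  (forall k, 0 < w0 k) -> (forall k, 0 < w1 k) -> (forall k, 0 < ws k) ->
  (forall k, ln (ws k) <= (1 - s) * ln (w0 k) + s * ln (w1 k)) ->
  0 < complex.Re (\det (gram b w0)) -> 0 < complex.Re (\det (gram b w1)) ->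
  0 < complex.Re (\det (gram b ws)) ->
  ln (complex.Re (\det (gram b ws))) <=
  (1 - s) * ln (complex.Re (\det (gram b w0))) + s * ln (complex.Re (\det (gram b w1))).
Proof.
move=> s01 w00 w10 ws0 wsle.
have [c c0 cE] := gram_det b; rewrite !cE.
pose th w f := \sum_i ln (w ((f : {ffun 'I_(d * d) -> K}) i)).
have E w : (forall k, 0 < w k) ->
    \sum_f c f * \prod_i w (f i) = \sum_f c f * expR (th w f).
  move=> wp; apply: eq_bigr => f _; congr (_ * _).
  by rewrite /th -ln_prod // lnK // posrE prodr_gt0.
rewrite !E // => F0 F1 Fs.
have le_s : \sum_f c f * expR (th ws f) <=
    \sum_f c f * expR ((1 - s) * th w0 f + s * th w1 f).
  apply: ler_sum => f _; apply: ler_wpM2l => //; rewrite ler_expR /th !mulr_sumr.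
  by rewrite -big_split /=; apply: ler_sum => i _.
apply: le_trans (ln_sum_expR_convex c0 s01 F0 F1 (lt_le_trans Fs le_s)).
by rewrite ler_ln ?posrE // (lt_le_trans Fs).
Qed.

Lemma gram_tr b w : \tr (gram b w) = \sum_k (w k)%:C * \tr ((b k)^t* *m b k).
Proof.
rewrite /gram linear_sum; apply: eq_bigr => k _; rewrite linearZ /=; congr (_ * _).
by rewrite mxtrace_mulC -vec_dot /mxtrace big_ord1.
Qed.

End rank_one_sums.

(** * The Hessian of [Lt] as a sum of rank-one matrices *)

Section hessian_of_Lt.
Context {R : realType} {d : nat}.
Local Notation C := R[i].
Variables (lam : R) (A : nat -> 'M[C]_d) (t : nat).
Implicit Types (S U V : 'M[C]_d) (q : 'I_d -> R) (al : 'I_t -> R).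

(* The matrices spanning the Hessian of [Lt] at [S diag(q) S^*]; they do not
   depend on [q], which only enters the weights. *)
Definition hvec S (k : 'I_d * 'I_d + 'I_t) : 'M[C]_d :=
  match k with
  | inl ij => invmx (S^t*) *m delta_mx ij.1 ij.2 *m invmx S
  | inr tau => A tau.+1
  end.

Definition hweight q al (k : 'I_d * 'I_d + 'I_t) : R :=
  match k with
  | inl ij => lam / (q ij.1 * q ij.2)
  | inr tau => (al tau)^-1 ^+ 2
  end.

Lemma trmxC_inv S : (invmx S)^t* = invmx (S^t*).
Proof. by rewrite trmx_inv map_invmx. Qed.

Lemma tr_delta (i j : 'I_d) (M : 'M[C]_d) : \tr (delta_mx j i *m M) = M i j.
Proof.
rewrite /mxtrace (bigD1 j) //= big1 ?addr0 => [|k kj].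
  rewrite mxE (bigD1 i) //= big1 ?addr0 => [|k ki]; first by rewrite mxE !eqxx mul1r.
  by rewrite mxE (negbTE ki) andbF mul0r.
by rewrite mxE big1 // => l _; rewrite mxE (negbTE kj) mul0r.
Qed.

Lemma hvec_dotr S ij U : \tr ((hvec S (inl ij))^t* *m U) =
  (invmx S *m U *m invmx (S^t*)) ij.1 ij.2.
Proof.
rewrite !trmxCM !trmxC_inv trmxCK trmx_delta map_delta_mx -!mulmxA mxtrace_mulC -!mulmxA.
by rewrite tr_delta mulmxA.
Qed.

Lemma hvec_dotl S ij V : V \is hermsymmx -> \tr (V^t* *m hvec S (inl ij)) =
  (invmx S *m V *m invmx (S^t*)) ij.2 ij.1.
Proof.
move=> /hermP ->; rewrite mxtrace_mulC /= -!mulmxA mxtrace_mulC -!mulmxA.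
by rewrite tr_delta mulmxA.
Qed.

Lemma congr_herm S V : V \is hermsymmx -> invmx S *m V *m invmx (S^t*) \is hermsymmx.
Proof.
by move=> /hermP Vh; apply/hermP; rewrite !trmxCM -!trmxC_inv trmxCK Vh mulmxA.
Qed.

Lemma tr_rdiag_quad q (X Y : 'M[C]_d) :
  lam%:C * \tr (rdiag (fun i => (q i)^-1) *m X *m (rdiag (fun i => (q i)^-1) *m Y)) =
  \sum_ij (lam / (q ij.1 * q ij.2))%:C * (X ij.2 ij.1 * Y ij.1 ij.2).
Proof.
rewrite -(pair_bigA _ (fun i j => (lam / (q i * q j))%:C * (X j i * Y i j))) /=.
rewrite exchange_big mulr_sumr; apply: eq_bigr => i _.
rewrite mxE mulr_sumr; apply: eq_bigr => j _.
rewrite !mul_diag_mx !mxE invfM.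
have -> : (lam * ((q j)^-1 * (q i)^-1))%:C = lam%:C * ((q j)^-1%:C * (q i)^-1%:C).
  by rewrite !rmorphM.
rewrite -!mulrA; congr (_ * _); rewrite [RHS]mulrCA; congr (_ * _).
exact: mulrCA.
Qed.

Hypothesis A_psd : forall tau, (1 <= tau <= t)%N -> psd (A tau) /\ A tau != 0.

(** The Hessian form of [- log det] is [tr (M^-1 V M^-1 U)]. In the coordinates of [S] it is the sum
    of [V'_ji U'_ij / (q_i q_j)], and each such entry is an inner product with a transported matrix
    unit. *)
Lemma hessian_Lt S q : S \in unitmx -> (forall i, 0 < q i) ->
  hessian (fun N => fine (Lt lam A t N)) (S *m rdiag q *m S^t*) =
  gram (hvec S) (hweight q (fun tau => complex.Re (\tr (A tau.+1 *m (S *m rdiag q *m S^t*))))).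
Proof.
move=> Su q0; set M := S *m rdiag q *m S^t*.
have Mp : posdefmx M by exact: posdef_rdiag.
have Mh := posdef_herm Mp.
have Ah (i : 'I_t) : A i.+1 \is hermsymmx.
  by case: (@A_psd i.+1) => [|[] //]; rewrite /= ltn_ord.
apply: hessian_unique => U V Uh Vh.
rewrite D2_Lreal // gram_form big_sumType /= addrC rmorphD; congr (_ + _).
  rewrite rmorph_sum; apply: eq_bigr => i _.
  have -> : \tr (V^t* *m A i.+1) = (complex.Re (\tr (A i.+1 *m V)))%:C.
    rewrite (hermE Vh) mxtrace_mulC; exact/esym/Re_tr_herm.
  have -> : \tr ((A i.+1)^t* *m U) = (complex.Re (\tr (A i.+1 *m U)))%:C.
    rewrite (hermE (Ah i)); exact/esym/Re_tr_herm.
  by rewrite -!rmorphM /= exprVn; congr (_%:C); rewrite mulrC [X in _ * X]mulrC.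
rewrite tr_inv_mul // => [|i]; last exact: lt0r_neq0.
set D := rdiag (fun i => (q i)^-1).
set V' := invmx S *m V *m _; set U' := invmx S *m U *m _.
have V'h : V' \is hermsymmx by exact: congr_herm.
have U'h : U' \is hermsymmx by exact: congr_herm.
have DWDh W : W \is hermsymmx -> D *m W *m D \is hermsymmx.
  by move=> /hermE WE; apply/hermP; rewrite !trmxCM rdiag_conj WE mulmxA.
(* The trace is real, being that of the product of the Hermitian matrices [D V' D] and [U']. *)
have zE : (complex.Re (\tr (D *m V' *m (D *m U'))))%:C = \tr (D *m V' *m (D *m U')).
  by rewrite mulmxA; exact: Re_tr_herm (DWDh _ V'h) U'h.
transitivity (lam%:C * \tr (D *m V' *m (D *m U'))).
  by rewrite -[in RHS]zE; exact: rmorphM.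
rewrite tr_rdiag_quad; apply: eq_bigr => ij _; congr (_ * _).
by rewrite (hvec_dotl S ij Vh) (hvec_dotr S ij U).
Qed.

End hessian_of_Lt.

(** * The volumetric potential *)

Section volumetric_potential.
Context {R : realType} {d : nat}.
Local Notation C := R[i].
Variables (lam : R) (A : nat -> 'M[C]_d).
Implicit Types (S U V M : 'M[C]_d) (q : 'I_d -> R) (t : nat).

Lemma ln_concave (a b s : R) : 0 < a -> 0 < b -> 0 <= s <= 1 ->
  (1 - s) * ln a + s * ln b <= ln ((1 - s) * a + s * b).
Proof.
move=> a0 b0 s01; rewrite -ler_expR lnK; last first.
  by rewrite posrE; case/andP: s01 => s0 s1; nra.
by apply: le_trans (expR_convex _ _ s01) _; rewrite !lnK ?posrE.
Qed.

(** In the coordinates of [S] the matrix [D] is diagonal, so only the diagonal matrix units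
    contribute. With [D = y - x] this evaluates the squared local norm. *)
Lemma gram_hvec_form t S q (w : 'I_d * 'I_d + 'I_t -> R) :
  (forall tau, (1 <= tau <= t)%N -> psd (A tau)) ->
  S \in unitmx ->
  let D := S *m rdiag q *m S^t* in
  ((vec D)^t* *m (gram (hvec A S) w *m vec D)) 0 0 =
  (\sum_i w (inl (i, i)) * q i ^+ 2
   + \sum_(tau < t) w (inr tau) * complex.Re (\tr (A tau.+1 *m D)) ^+ 2)%:C.
Proof.
move=> Ap Su D; have Dh : D \is hermsymmx by exact: rdiag_herm.
have DE : invmx S *m D *m invmx (S^t*) = rdiag q.
  by rewrite /D !mulmxA mulVmx // mul1mx mulmxK // unitmx_trmxC.
rewrite gram_form big_sumType rmorphD; congr (_ + _); last first.
  rewrite rmorph_sum; apply: eq_bigr => tau _; rewrite rmorphM; congr (_ * _).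
  have Ah : A tau.+1 \is hermsymmx by case: (Ap tau.+1) => //=; rewrite ltn_ord.
  by rewrite /= (hermE Dh) (hermE Ah) mxtrace_mulC -(Re_tr_herm Ah Dh) expr2 rmorphM.
rewrite rmorph_sum.
transitivity (\sum_(p : 'I_d * 'I_d)
    (w (inl (p.1, p.2)))%:C * (rdiag q p.2 p.1 * rdiag q p.1 p.2)).
  apply: eq_bigr => -[i j] _.
  by rewrite (@hvec_dotl R d A t S (i, j) D Dh) (@hvec_dotr R d A t S (i, j) _) DE.
rewrite -(pair_bigA _ (fun i j => (w (inl (i, j)))%:C * (rdiag q j i * rdiag q i j))) /=.
apply: eq_bigr => i _; rewrite (bigD1 i) //= big1 ?addr0 => [|j ji].
  by rewrite !mxE eqxx mulr1n expr2 !rmorphM.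
by rewrite !mxE (negbTE ji) mulr0n mul0r mulr0.
Qed.

(** Undoing the congruence gives [0 <= q i]; the determinant rules out 0. *)
Lemma posdef_rdiag_gt0 S q i : posdefmx (S *m rdiag q *m S^t*) -> S \in unitmx -> 0 < q i.
Proof.
move=> yp Su; have := posdef_det_gt0 yp; rewrite Re_det_rdiag pmulr_rgt0 ?Re_normdet_gt0 //.
move=> /lt0r_neq0 /prodf_neq0 /(_ i isT) qi.
rewrite lt_def qi /=; have [S0 _ yE] := yp.
have yP : psdmx (S *m rdiag q *m S^t*) by rewrite yE; exact: sqr_psd.
have := psdmx_diag_ge0 i (psdmx_congr (invmx (S^t*)) yP).
rewrite -trmxC_inv trmxCK !mulmxA mulVmx // mul1mx -mulmxA -trmxCM mulVmx // trmx1 map_mx1.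
by rewrite mulmx1 !mxE eqxx mulr1n lecR.
Qed.

(** A kernel vector is orthogonal to all [hvec A S k], in particular to the transported matrix
    units, which already span the whole space. *)
Lemma gram_hvec_det_gt0 t S (w : 'I_d * 'I_d + 'I_t -> R) :
  S \in unitmx -> (forall k, 0 < w k) -> 0 < \det (gram (hvec A S) w).
Proof.
move=> Su w0; have Gp : psdmx (gram (hvec A S) w) by apply: gram_psd => k; exact: ltW.
have [dG _] := andP (psdmx_det_le_tr Gp); rewrite lt_def dG andbT.
apply/negP => /det0P[v vneq0 vG]; case/negP: vneq0; apply/eqP.
have [V VE] := vec_surj (v^t*).
have vVE : v = (vec V)^t* by rewrite -VE trmxCK.
have := gram_form (hvec A S) w V V; rewrite mulmxA -vVE vG mul0mx mxE.
have F0 k : 0 <= (w k)%:C * (\tr (V^t* *m hvec A S k) * \tr ((hvec A S k)^t* *m V)).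
  apply: mulr_ge0; first by rewrite lecR ltW.
  have -> : \tr (V^t* *m hvec A S k) = (\tr ((hvec A S k)^t* *m V))^*%R.
    by rewrite -trace_trmxC trmxCM trmxCK.
  by rewrite mulrC -normCK exprn_ge0.
move=> /esym/eqP; rewrite psumr_eq0 // => /allP all0.
suff VZ : V = 0 by rewrite vVE VZ /vec trmx0 linear0 !trmx0 map_mx0.
have V'0 : invmx S *m V *m invmx (S^t*) = 0.
  apply/matrixP => i j; rewrite [RHS]mxE.
  have := all0 (inl (i, j)) (mem_index_enum _).
  rewrite mulf_eq0 => /orP[/eqP h|].
    by have := w0 (inl (i, j)); rewrite -ltcR h ltxx.
  have -> : \tr (V^t* *m @hvec R d A t S (inl (i, j))) =
      (\tr ((@hvec R d A t S (inl (i, j)))^t* *m V))^*%R.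
    by rewrite -trace_trmxC trmxCM trmxCK.
  by rewrite mulrC -normCK expf_eq0 normr_eq0 (@hvec_dotr R d A t S (i, j) _) /= => /eqP.
have Stu : S^t* \in unitmx by rewrite unitmx_trmxC.
have -> : V = S *m (invmx S *m V *m invmx (S^t*)) *m S^t*.
  by rewrite !mulmxA mulmxV // mul1mx mulmxKV.
by rewrite V'0 mulmx0 mul0mx.
Qed.

(** Rules out zero announcements, so that [Lt] is finite on positive definite matrices. *)
Definition alive t := forall tau, (1 <= tau <= t)%N -> psd (A tau) /\ A tau != 0.

Lemma Vt_rdiag t S q : alive t -> S \in unitmx -> (forall i, 0 < q i) ->
  Vt lam A t (S *m rdiag q *m S^t*) = 2^-1 * ln (complex.Re (\det (gram (hvec A S)
    (hweight lam q (fun tau : 'I_t => complex.Re (\tr (A tau.+1 *m (S *m rdiag q *m S^t*)))))))).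
Proof. by move=> Al Su q0; rewrite /Vt hessian_Lt. Qed.

Hypothesis lam_gt0 : 0 < lam.

Lemma hweight_gt0 t q (al : 'I_t -> R) k : (forall i, 0 < q i) -> (forall i, 0 < al i) ->
  0 < hweight lam q al k.
Proof.
by move=> q0 a0; case: k => [ij|tau] /=; rewrite ?divr_gt0 ?mulr_gt0 ?exprn_gt0 ?invr_gt0.
Qed.

Lemma alive_tr_gt0 t M (i : 'I_t) : alive t -> posdefmx M ->
  0 < complex.Re (\tr (A i.+1 *m M)).
Proof.
by move=> Al Mp; have [|] := Al i.+1; [rewrite /= ltn_ord|move=> *; exact: posdef_tr_gt0].
Qed.

Lemma segment_rdiag S q (s : R) :
  (1 - s)%:C *: (S *m S^t*) + s%:C *: (S *m rdiag q *m S^t*) =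
  S *m rdiag (fun i => 1 - s + s * q i) *m S^t*.
Proof.
rewrite -{1}[S]mulmx1 -rdiag1 rdiag_affine.
by under eq_fun do rewrite mulr1.
Qed.

Lemma Vt_convex t x y (s : R) : alive t -> posdefmx x -> posdefmx y -> 0 <= s <= 1 ->
  Vt lam A t ((1 - s)%:C *: x + s%:C *: y) <= (1 - s) * Vt lam A t x + s * Vt lam A t y.
Proof.
move=> Al xp yp s01.
have [S [q [Su xE yE]]] := real_simultaneous_diagonalization xp (posdef_herm yp).
have q0 i : 0 < q i by apply: (@posdef_rdiag_gt0 S q i) => //; rewrite -yE.
have xE1 : x = S *m rdiag (fun=> 1) *m S^t* by rewrite rdiag1 mulmx1.
have [s0 s1] := andP s01.
have qs0 i : 0 < 1 - s + s * q i by have := q0 i; nra.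
have zE : (1 - s)%:C *: x + s%:C *: y = S *m rdiag (fun i => 1 - s + s * q i) *m S^t*.
  by rewrite xE yE segment_rdiag.
have zp : posdefmx (S *m rdiag (fun i => 1 - s + s * q i) *m S^t*) by exact: posdef_rdiag.
have alE (tau : 'I_t) : complex.Re (\tr (A tau.+1 *m (S *m rdiag (fun i => 1 - s + s * q i) *m S^t*)))
    = (1 - s) * complex.Re (\tr (A tau.+1 *m x)) + s * complex.Re (\tr (A tau.+1 *m y)).
  by rewrite -zE mulmxDr -!scalemxAr linearD !linearZ /= ReD !ReZ.
rewrite zE [in X in _ <= X]xE1 [in X in _ <= X]yE !Vt_rdiag // -xE1 -yE.
rewrite !(mulrCA _ 2^-1) -mulrDr ler_pM2l //.
have xal i := alive_tr_gt0 i Al xp; have yal i := alive_tr_gt0 i Al yp.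
have zal i := alive_tr_gt0 i Al zp.
have det_gt0 p (al : 'I_t -> R) : (forall i, 0 < p i) -> (forall i, 0 < al i) ->
    0 < complex.Re (\det (gram (hvec A S) (hweight lam p al))).
  by move=> p0 al0; apply/Re_gt0/gram_hvec_det_gt0 => // k; exact: hweight_gt0.
apply: gram_det_log_convex => //; try by move=> k; exact: hweight_gt0.
(* The logarithm of each weight is a constant minus two logarithms of positive affine functions of
   [s]; concavity of [ln] gives the required bound. *)
- case=> [[i j]|tau] /=.
    rewrite !ln_div ?posrE ?mulr_gt0 // !lnM ?posrE //.
    have := ln_concave (@ltr01 R) (q0 i) s01; have := ln_concave (@ltr01 R) (q0 j) s01.
    rewrite !ln1 !mulr0 !mulr1; lra.
  move: (zal tau) (xal tau) (yal tau); rewrite alE.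
  move: (complex.Re _) (complex.Re _) => a b c0 a0 b0.
  rewrite !lnXn ?invr_gt0 // !lnV ?posrE // !mulr2n.
  have := ln_concave a0 b0 s01; lra.
- exact: det_gt0.
- exact: det_gt0.
- exact: det_gt0.
Qed.

Lemma gram_hvec_succ t S q M : gram (hvec A S) (hweight lam q
     (fun tau : 'I_t.+1 => complex.Re (\tr (A tau.+1 *m M)))) =
  gram (hvec A S) (hweight lam q (fun tau : 'I_t => complex.Re (\tr (A tau.+1 *m M))))
  + ((complex.Re (\tr (A t.+1 *m M)))^-1%:C *: vec (A t.+1)) *m
    ((complex.Re (\tr (A t.+1 *m M)))^-1%:C *: vec (A t.+1))^t*.
Proof.
rewrite /gram !big_sumType /= big_ord_recr /= addrA; congr (_ + _).
rewrite linearZ /= map_mxZ -scalemxAl -scalemxAr scalerA; congr (_ *: _).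
rewrite expr2 rmorphM; congr (_ * _); exact/esym/conjC_RtoC.
Qed.

(* The squared norm of [y - x] in the Hessian at [y], for [x = S S^*] and
   [y = S diag(q) S^*]; [al] and [be] are the traces against [x] and [y]. *)
Definition sq_local_norm t (al be : 'I_t -> R) q : R :=
  lam * \sum_i (1 - (q i)^-1) ^+ 2 + \sum_(tau < t) (1 - al tau / be tau) ^+ 2.

Lemma Vt_succ_ge t x y S q : alive t.+1 -> S \in unitmx -> (forall i, 0 < q i) ->
  x = S *m S^t* -> y = S *m rdiag q *m S^t* ->
  let al n := complex.Re (\tr (A n.+1 *m x)) in
  let be n := complex.Re (\tr (A n.+1 *m y)) in
  let r2 := sq_local_norm (fun i : 'I_t => al i) (fun i : 'I_t => be i) q in
  0 < r2 ->
  Vt lam A t y + 2^-1 * ln (1 + (1 - al t / be t) ^+ 2 / r2) <= Vt lam A t.+1 y.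
Proof.
move=> Al Su q0 xE yE al be r2 r20.
have Al' : alive t by move=> tau /andP[h1 h2]; apply: Al; rewrite h1 leqW.
have yp : posdefmx y by rewrite yE; exact: posdef_rdiag.
have be0 i : (i < t.+1)%N -> 0 < be i.
  by move=> h; exact: (@alive_tr_gt0 t.+1 y (Ordinal h) Al yp).
rewrite yE !Vt_rdiag // -yE -mulrDr ler_pM2l // gram_hvec_succ.
set G := gram _ _; set g := _ *: _.
have w0 k : 0 < hweight lam q (fun tau : 'I_t => complex.Re (\tr (A tau.+1 *m y))) k.
  by apply: hweight_gt0 => // i; apply: be0; rewrite ltnS ltnW.
have Gdet : 0 < \det G by apply: gram_hvec_det_gt0.
have Gp : psdmx G by apply: gram_psd => k; exact: ltW.
(* The test vector for the rank-one update is [D = y - x]: its [G]-form is [r2], and its product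
   with [g] is [1 - al t / be t]. *)
pose D := S *m rdiag (fun i => q i - 1) *m S^t*.
have yxD : y = x + 1%:C *: D.
  rewrite xE /D sqr_rdiag_affine yE; congr (_ *m rdiag _ *m _).
  by apply/funext => i; rewrite mul1r addrC subrK.
have trD n : complex.Re (\tr (A n.+1 *m D)) = be n - al n.
  by rewrite /be yxD Re_tr_affine mul1r addrC addKr.
have r2E : (vec D)^t* *m G *m vec D = r2%:C%:M.
  rewrite [LHS]mx11_scalar -mulmxA; congr (_%:M).
  rewrite gram_hvec_form //; last by move=> tau /Al'[].
  congr (_%:C); rewrite /r2 /sq_local_norm mulr_sumr; congr (_ + _); apply: eq_bigr => i _ /=.
    by have := q0 i => /lt0r_neq0 qi; field.
  have := be0 i (ltn_trans (ltn_ord i) (ltnSn t)) => /lt0r_neq0 bi.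
  by rewrite trD; change (complex.Re (\tr (A i.+1 *m y))) with (be i); field.
have gD : (g^t* *m vec D) 0 0 = (1 - al t / be t)%:C.
  have Ah : A t.+1 \is hermsymmx by case: (Al t.+1) => [|[]//]; rewrite /= leqnn.
  rewrite /g linearZ /= map_mxZ -scalemxAl mxE vec_dot (hermE Ah).
  rewrite -(Re_tr_herm Ah (rdiag_herm _ _)) trD.
  transitivity ((be t)^-1%:C * (be t - al t)%:C); first by congr (_ * _); exact: conjC_RtoC.
  rewrite -rmorphM /=; congr (_%:C).
  by have := be0 t (ltnSn t) => /lt0r_neq0 bt; field.
have form_gt0 : 0 < ((vec D)^t* *m G *m vec D) 0 0 by rewrite r2E !mxE ltcR.
have := det_rank1_update_ge g Gp Gdet form_gt0.
rewrite r2E gD mxE eqxx mulr1n => hle.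
have bt0 : 0 <= (1 - al t / be t) ^+ 2 / r2 by rewrite divr_ge0 ?sqr_ge0 // ltW.
have nE : `|(1 - al t / be t)%:C| ^+ 2 / r2%:C = ((1 - al t / be t) ^+ 2 / r2)%:C.
  rewrite normCK; move: (1 - al t / be t) => u.
  transitivity (u%:C * u%:C / r2%:C); first by congr (_ * _ / _); exact: conjC_RtoC.
  by rewrite -expr2 rmorphM fmorphV rmorphXn.
rewrite nE in hle.
have dG0 := Re_gt0 Gdet.
have hle2 : complex.Re (\det G) * (1 + (1 - al t / be t) ^+ 2 / r2)
    <= complex.Re (\det (G + g *m g^t*)).
  move: hle; rewrite lecE => /andP[_]; apply: le_trans.
  rewrite mulrC -ReZ le_eqVlt; apply/orP; left; apply/eqP; congr complex.Re.
  by rewrite mulrC rmorphD.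
rewrite -lnM ?posrE //; last by rewrite ltr_pwDl.
have p0 : 0 < complex.Re (\det G) * (1 + (1 - al t / be t) ^+ 2 / r2).
  by rewrite mulr_gt0 // ltr_pwDl.
by rewrite ler_ln ?posrE // (lt_le_trans p0).
Qed.

End volumetric_potential.

(** * One round of the algorithm *)

Section step.
Context {R : realType}.
Local Notation C := R[i].

Lemma psi_mono (m q : R) : 1 <= m -> m <= q -> m - 1 - ln m <= q - 1 - ln q.
Proof.
move=> m1 mq; have m0 : 0 < m by lra.
have q0 : 0 < q by lra.
have := ln_le_sub1 (divr_gt0 q0 m0); rewrite ln_div ?posrE // => h.
have : q / m - 1 <= q - m.
  have -> : q / m - 1 = (q - m) / m by field; rewrite gt_eqF.
  by rewrite ler_pdivrMr //; nra.
lra.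
Qed.

(** One round in coordinates. The [1 + eta k] are the eigenvalue and trace ratios of [y] to [x], [m]
    is the trace ratio for the new observation, [c] is the scaled change of the volumetric part from
    [x] to [y], and [dV] is its increase at [y] over the round. *)
Lemma scalar_step (I : finType) (w eta : I -> R) (c m dV : R) :
  (forall k, 1 <= w k) -> (forall k, 0 < 1 + eta k) -> 0 < m -> 0 <= dV ->
  (forall s, 0 < s < 1 -> 0 <= - (\sum_k w k * ln (1 + s * eta k)) + s * c) ->
  (1 < m -> exists2 k, 300 <= w k & m <= 1 + eta k) ->
  (let r2 := \sum_k w k * (1 - (1 + eta k)^-1) ^+ 2 in
   0 < r2 -> 2^-1 * ln (1 + (1 - m^-1) ^+ 2 / r2) <= dV) ->
  ln m <= - (\sum_k w k * ln (1 + eta k)) + c + 10 * dV.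
Proof.
move=> w1 e0 m0 dV0 foc mmax; set r2 := \sum_k _ => /= hdV.
have w0 k : 0 <= w k by apply: le_trans (w1 k).
have sumc : \sum_k w k * eta k <= c by exact: first_order_condition foc.
pose psi k := 1 + eta k - 1 - ln (1 + eta k).
have psi0 k : 0 <= psi k.
  by rewrite /psi; have := ln_le_sub1 (e0 k); lra.
pose B := \sum_k w k * psi k.
have BE : B = \sum_k w k * eta k - \sum_k w k * ln (1 + eta k).
  rewrite /B -sumrB; apply: eq_bigr => k _; rewrite /psi; ring.
have Bk k : w k * psi k <= B.
  by rewrite /B (bigD1 k) //= lerDl sumr_ge0 // => l _; rewrite mulr_ge0.
have B0 : 0 <= B by apply: sumr_ge0 => k _; rewrite mulr_ge0.
suff : ln m <= B + 10 * dV by lra.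
have [m1|m1] := leP m 1; first by have := ln_le0 m1; lra.
have [k wk mk] := mmax m1.
(* [psi] increases beyond 1, and [m] is below a ratio of weight at least 300. *)
have B300 : 300 * (m - 1 - ln m) <= B.
  apply: le_trans (Bk k); have := psi_mono (ltW m1) mk; rewrite -/(psi k) => h.
  have h0 : 0 <= m - 1 - ln m by have := ln_le_sub1 m0; lra.
  by have := psi0 k; nra.
have term0 l : 0 <= w l * (1 - (1 + eta l)^-1) ^+ 2 by rewrite mulr_ge0 ?sqr_ge0.
have r20 : 0 < r2.
  rewrite /r2 (bigD1 k) //= ltr_pwDl ?sumr_ge0 //.
  rewrite mulr_gt0 ?exprn_even_gt0 //=; first lra.
  by rewrite subr_eq0 eq_sym invr_eq1; apply/eqP; lra.
(* Weights are at least 1, so one large [psi l] makes [B] large; otherwise the second alternative of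
   [psi_ge] holds for every term. *)
have hB : 16^-1 <= B \/ r2 / 16 <= B.
  have [/existsP[l hl]|] := boolP [exists l, 16^-1 <= psi l].
    by left; apply: le_trans (Bk l); have := w1 l; nra.
  rewrite negb_exists => /forallP hn; right.
  rewrite /r2 mulr_suml; apply: ler_sum => l _; rewrite -mulrA; apply: ler_wpM2l => //.
  by have [h|//] := psi_ge (e0 l); move: (hn l); rewrite h.
have := log_tradeoff m1 r20 B300 hB; have := hdV r20; lra.
Qed.

Variables (d : nat) (A : nat -> 'M[C]_d).
Let lam : R := 300.
Hypothesis d_gt0 : (0 < d)%N.

(** Read off from [Vt_succ_ge] with [x = y / 4]: a reference point different from [y] is needed to
    make [r2] positive, and the added logarithm is nonnegative. *)
Lemma Vt_mono t y : alive A t.+1 -> posdefmx y -> Vt lam A t y <= Vt lam A t.+1 y.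
Proof.
move=> Al [S0 S0u yE].
pose S := (2^-1 : R)%:C *: S0.
have Su : S \in unitmx by rewrite unitmxZ // unitfE gt_eqF // ltcR invr_gt0.
have yE2 : y = S *m rdiag (fun=> 4) *m S^t*.
  rewrite yE /S linearZ /= map_mxZ -!scalemxAl -scalemxAr scalerA.
  have -> : rdiag (fun=> 4) = (4 : R)%:C *: 1%:M :> 'M[C]_d.
    rewrite -rdiag1; apply/matrixP => i j; rewrite !mxE.
    by case: eqP => _; rewrite ?mulr1n ?mulr0n ?mulr0 // -rmorphM mulr1.
  rewrite -scalemxAr mulmx1 -scalemxAl scalerA -[LHS]scale1r; congr (_ *: _).
  transitivity ((2^-1 : R)%:C * (2^-1 : R)%:C * (4 : R)%:C); last first.
    by congr (_ * _ * _); exact/esym/conjC_RtoC.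
  by rewrite -!rmorphM; congr (_%:C); field.
have := Vt_succ_ge (lam := lam) _ Al Su (fun=> _) erefl yE2.
move=> /(_ ltac:(by []) ltac:(by [])) /=; set r2 := sq_local_norm _ _ _ _.
have r20 : 0 < r2.
  rewrite /r2 /sq_local_norm ltr_pwDl //; last by apply: sumr_ge0 => i _; exact: sqr_ge0.
  rewrite mulr_gt0 // sumr_const card_ord pmulrn_lgt0 //.
  by apply: exprn_gt0; lra.
move=> /(_ r20); apply: le_trans; rewrite lerDl mulr_ge0 // ln_ge0 // lerDl.
by rewrite divr_ge0 ?sqr_ge0 // ltW.
Qed.

(* The trace ratio [tr (B y) / tr (B x)] is a weighted mean of the [q i]. *)
Lemma tr_ratio_le_eigen (B S : 'M[C]_d) q (m : R) : psd B -> S \in unitmx -> B != 0 ->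
  complex.Re (\tr (B *m (S *m rdiag q *m S^t*))) = m * complex.Re (\tr (B *m (S *m S^t*))) ->
  exists i, m <= q i.
Proof.
move=> Bp Su B0.
have Re_tr p : complex.Re (\tr (B *m (S *m rdiag p *m S^t*))) =
    \sum_i p i * complex.Re ((S^t* *m B *m S) i i).
  rewrite mxtrace_mulC -!mulmxA mxtrace_mulC -!mulmxA.
  rewrite tr_rdiag_mul Re_sum; apply: eq_bigr => i _; rewrite ReZ.
  by rewrite mulmxA.
have := posdef_tr_gt0 Bp B0 (ex_intro2 _ _ S Su erefl).
have SSE : S *m S^t* = S *m rdiag (fun=> 1) *m S^t* by rewrite rdiag1 mulmx1.
rewrite SSE (Re_tr (fun=> 1)) (Re_tr q) => apos hm.
have a0 i : 0 <= complex.Re ((S^t* *m B *m S) i i).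
  by have := psdmx_diag_ge0 i (psdmx_congr S Bp); rewrite lecE => /andP[].
pose a i := complex.Re ((S^t* *m B *m S) i i).
have apos' : 0 < \sum_i a i.
  by move: apos; rewrite (eq_bigr a) // => i _; rewrite mul1r.
have hm' : \sum_i q i * a i = m * \sum_i a i.
  by rewrite hm; congr (_ * _); apply: eq_bigr => i _; rewrite mul1r.
apply: contrapT => /forallNP hn.
have : \sum_i (m - q i) * a i = 0.
  under eq_bigr do rewrite mulrBl.
  by rewrite sumrB -mulr_sumr hm' subrr.
have h0 i : 0 < m - q i by rewrite subr_gt0 ltNge; apply/negP/hn.
move=> /eqP; rewrite psumr_eq0 => [/allP hz|i _]; last first.
  by apply: mulr_ge0; [exact/ltW|exact: a0].
move: apos'; rewrite big1 ?ltxx // => i _.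
have := hz i (mem_index_enum i); rewrite mulf_eq0 gt_eqF //= => /eqP.
by [].
Qed.

Lemma sum_ln_segment (I : finType) (al be : I -> R) s : 0 <= s <= 1 ->
  (forall i, 0 < al i) -> (forall i, 0 < be i) ->
  \sum_i ln ((1 - s) * al i + s * be i) =
  \sum_i ln (al i) + \sum_i ln (1 + s * (be i / al i - 1)).
Proof.
move=> /andP[s0 s1] al0 be0; rewrite -big_split /=; apply: eq_bigr => i _.
move: (al i) (be i) (al0 i) (be0 i) => a b a0 b0.
have an0 := lt0r_neq0 a0.
have E : 1 + s * (b / a - 1) = ((1 - s) * a + s * b) / a by field.
have p0 : 0 < (1 - s) * a + s * b by nra.
by rewrite E ln_div ?posrE // addrC subrK.
Qed.

Lemma Re_tr_segment (B x y : 'M[C]_d) (s : R) :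
  complex.Re (\tr (B *m ((1 - s)%:C *: x + s%:C *: y))) =
  (1 - s) * complex.Re (\tr (B *m x)) + s * complex.Re (\tr (B *m y)).
Proof.
rewrite mulmxDr -!scalemxAr linearD !linearZ /=.
by move: (\tr _) (\tr _) => a b; rewrite ReD !ReZ.
Qed.

Lemma Lreal_segment t S q s : alive A t -> S \in unitmx -> (forall i, 0 < q i) ->
  0 <= s <= 1 ->
  let x := S *m S^t* in let y := S *m rdiag q *m S^t* in
  Lreal lam A t ((1 - s)%:C *: x + s%:C *: y) = Lreal lam A t x
  - \sum_(i < t) ln (1 + s * (complex.Re (\tr (A i.+1 *m y)) / complex.Re (\tr (A i.+1 *m x)) - 1))
  - lam * \sum_i ln (1 + s * (q i - 1)).
Proof.
move=> Al Su q0 s01 x y; have [s0 s1] := andP s01.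
have xE : x = S *m rdiag (fun=> 1) *m S^t* by rewrite rdiag1 mulmx1.
have xp : posdefmx x by exists S.
have yp : posdefmx y by exact: posdef_rdiag.
pose al (i : 'I_t) := complex.Re (\tr (A i.+1 *m x)).
pose be (i : 'I_t) := complex.Re (\tr (A i.+1 *m y)).
have al0 i : 0 < al i := alive_tr_gt0 i Al xp.
have be0 i : 0 < be i := alive_tr_gt0 i Al yp.
have qs0 i : 0 < 1 - s + s * q i by have := q0 i; nra.
have trE : \sum_(i < t) ln (complex.Re (\tr (A i.+1 *m ((1 - s)%:C *: x + s%:C *: y)))) =
    \sum_i ln (al i) + \sum_i ln (1 + s * (be i / al i - 1)).
  rewrite -sum_ln_segment //; apply: eq_bigr => i _; congr ln; exact: Re_tr_segment.
have zE : (1 - s)%:C *: x + s%:C *: y = S *m rdiag (fun i => 1 - s + s * q i) *m S^t*.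
  exact: segment_rdiag.
have dz : ln (complex.Re (\det ((1 - s)%:C *: x + s%:C *: y))) =
    ln (complex.Re (`|\det S| ^+ 2)) + \sum_i ln (1 + s * (q i - 1)).
  rewrite zE Re_det_rdiag lnM ?posrE ?Re_normdet_gt0 ?prodr_gt0 // ln_prod //.
  by congr (_ + _); apply: eq_bigr => i _; congr ln; ring.
have dx : ln (complex.Re (\det x)) = ln (complex.Re (`|\det S| ^+ 2)).
  by rewrite xE Re_det_rdiag big1_eq mulr1.
rewrite /Lreal trE dz dx -/al -/be.
move: (\sum_i ln (al i)) (\sum_i ln (1 + s * (be i / al i - 1))) (\sum_i _) (ln _).
by move=> a b c e; ring.
Qed.

(** [W] stands for the volumetric term actually present in [P_t], which is 0 at [t = 0]; hence only
    [W y <= Vt lam A t y] is required instead of equality. *)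
Lemma vbftrl_step t (W : 'M[C]_d -> R) x y : alive A t.+1 -> posdefmx x -> posdefmx y ->
  (forall s, 0 < s < 1 -> let z := (1 - s)%:C *: x + s%:C *: y in
    Lreal lam A t x + 10 * W x <= Lreal lam A t z + 10 * W z /\
    W z <= (1 - s) * W x + s * W y) ->
  W y <= Vt lam A t y ->
  Lreal lam A t x + 10 * W x - ln (complex.Re (\tr (A t.+1 *m x))) <=
  Lreal lam A t.+1 y + 10 * Vt lam A t.+1 y.
Proof.
move=> Al xp yp min Wy.
have Al' : alive A t by move=> tau /andP[h1 h2]; apply: Al; rewrite h1 leqW.
have [S [q [Su xE yE]]] := real_simultaneous_diagonalization xp (posdef_herm yp).
have q0 i : 0 < q i by apply: (@posdef_rdiag_gt0 R d S q i) => //; rewrite -yE.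
have zE s : 0 <= s <= 1 -> Lreal lam A t ((1 - s)%:C *: x + s%:C *: y) = Lreal lam A t x
  - \sum_(i < t) ln (1 + s * (complex.Re (\tr (A i.+1 *m y)) / complex.Re (\tr (A i.+1 *m x)) - 1))
  - lam * \sum_i ln (1 + s * (q i - 1)).
  by move=> s01; rewrite xE yE Lreal_segment.
have Vm := Vt_mono Al yp.
have Vs := Vt_succ_ge (lam := lam) _ Al Su q0 xE yE.
have mq := @tr_ratio_le_eigen (A t.+1) S q.
have [Ap A0] : psd (A t.+1) /\ A t.+1 != 0 by apply: Al; rewrite /= leqnn.
have := mq _ Ap Su A0; rewrite -xE -yE => {}mq.
have LyE : Lreal lam A t.+1 y = Lreal lam A t y - ln (complex.Re (\tr (A t.+1 *m y))).
  by rewrite /Lreal big_ord_recr /= opprD addrAC.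
have alt0 := @alive_tr_gt0 R d A t.+1 x ord_max Al xp.
have bet0 := @alive_tr_gt0 R d A t.+1 y ord_max Al yp.
rewrite /= in alt0 bet0.
pose al (i : 'I_t) := complex.Re (\tr (A i.+1 *m x)).
pose be (i : 'I_t) := complex.Re (\tr (A i.+1 *m y)).
have al0 i : 0 < al i := alive_tr_gt0 i Al' xp.
have be0 i : 0 < be i := alive_tr_gt0 i Al' yp.
pose w (k : 'I_t + 'I_d) : R := if k is inr _ then lam else 1.
pose eta (k : 'I_t + 'I_d) : R := match k with inl i => be i / al i - 1 | inr i => q i - 1 end.
have zE' s : 0 <= s <= 1 -> Lreal lam A t ((1 - s)%:C *: x + s%:C *: y) =
    Lreal lam A t x - \sum_k w k * ln (1 + s * eta k).
  move=> s01; rewrite zE // big_sumType /= opprD addrA mulr_sumr; congr (_ - _ - _).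
  by apply: eq_bigr => i _; rewrite mul1r.
clear zE.
have Ly : Lreal lam A t y = Lreal lam A t x - \sum_k w k * ln (1 + eta k).
  have := zE' 1; rewrite subrr scale0r add0r scale1r => ->; last by rewrite ler01 lexx.
  by under eq_bigr do rewrite mul1r.
have e0 k : 0 < 1 + eta k.
  by case: k => i /=; rewrite addrC subrK // divr_gt0.
have r2E : sq_local_norm lam al be q = \sum_k w k * (1 - (1 + eta k)^-1) ^+ 2.
  rewrite /sq_local_norm big_sumType /= [RHS]addrC mulr_sumr; congr (_ + _); apply: eq_bigr => i _.
    by rewrite [1 + (_ - 1)]addrC subrK.
  by rewrite mul1r [1 + (_ - 1)]addrC subrK invf_div.
move: Vs; rewrite /= => /(_ ltac:(by rewrite ltr0n)); rewrite -/al -/be r2E => Vs.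
(* Inserting the chord bound for [W] into minimality leaves [s] times [10 * (W y - W x)], which is
   the slope [c]. *)
have h := @scalar_step _ w eta (10 * (W y - W x))
  (complex.Re (\tr (A t.+1 *m y)) / complex.Re (\tr (A t.+1 *m x)))
  (Vt lam A t.+1 y - W y).
move: alt0 bet0 mq Vs h; rewrite LyE Ly.
move: (complex.Re _) (complex.Re _) => b a a0 b0 mq Vs h.
have ba0 : 0 < b / a by rewrite divr_gt0.
have : ln (b / a) <= - (\sum_k w k * ln (1 + eta k)) + 10 * (W y - W x)
    + 10 * (Vt lam A t.+1 y - W y).
  apply: h => //.
  - by case=> i; rewrite /w // /lam ler1n.
  - by rewrite subr_ge0; exact: le_trans Wy Vm.
  - move=> s s01; have [] := min s s01.
    have s01' : 0 <= s <= 1 by case/andP: s01 => s0 s1; rewrite !ltW.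
    rewrite (zE' s s01').
    move: (W _) (W x) (W y) (Lreal _ _ _ _) (\sum_k _) => wz wx wy l sm h1 h2.
    by clear -h1 h2; lra.
  - move=> _; have [|i hi] := mq (b / a); first by field; rewrite gt_eqF.
    by exists (inr i) => //=; rewrite addrC subrK.
  - move=> r2 r20; have := Vs r20; rewrite invf_div -/r2.
    move: Wy; move: (W y) (Vt lam A t y) (Vt lam A t.+1 y) (ln _) => wy v v' l h1 h2.
    by clear -h1 h2; lra.
rewrite ln_div ?posrE //.
move: (ln b) (ln a) (\sum_k _) (Vt _ _ _ _) (Lreal _ _ _ _) (W x) (W y) => lb la sm v l wx wy h1.
by clear -h1; lra.
Qed.

End step.

(** * Bounds for density matrices and for the mixed comparator *)

Section density_bounds.
Context {R : realType} {d : nat}.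
Local Notation C := R[i].
Variables (lam : R) (A : nat -> 'M[C]_d).
Hypothesis lam_ge1 : 1 <= lam.

Lemma unitary_diagonalization (y : 'M[C]_d) : y \is hermsymmx ->
  exists (S : 'M[C]_d) (q : 'I_d -> R), [/\ S \in unitmx, 1%:M = S *m S^t*,
    invmx S = S^t*, invmx (S^t*) = S & y = S *m rdiag q *m S^t*].
Proof.
move=> yh; have p1 : posdefmx (1%:M : 'M[C]_d).
  by exists 1%:M; rewrite ?unitmx1 // trmx1 map_mx1 mulmx1.
have [S [q [Su SE yE]]] := real_simultaneous_diagonalization p1 yh.
have iS : invmx S = S^t* by rewrite -[S^t*](mulKmx Su) -SE mulmx1.
exists S, q; split; [exact: Su|exact: SE|exact: iS| |exact: yE].
by rewrite -iS invmxK.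
Qed.

Lemma tr_rdiag_unitary (S : 'M[C]_d) q : 1%:M = S *m S^t* ->
  \tr (S *m rdiag q *m S^t*) = (\sum_i q i)%:C.
Proof.
move=> SE; rewrite mxtrace_mulC mulmxA.
have -> : S^t* *m S = 1%:M by apply: mulmx1C.
rewrite mul1mx mxtrace_diag rmorph_sum; apply: eq_bigr => i _.
by rewrite mxE.
Qed.

(** Unitarily conjugated matrix units form an orthonormal basis, so their rank-one projections sum
    to the identity. *)
Lemma gram_unitary (S : 'M[C]_d) : S \in unitmx -> 1%:M = S *m S^t* ->
  invmx S = S^t* -> invmx (S^t*) = S ->
  gram (hvec A (t := 0) S) (fun=> 1) = 1%:M.
Proof.
move=> Su SE iS iS'; have SE' : S^t* *m S = 1%:M by apply: mulmx1C.
apply: vec_form_inj => U V; rewrite mul1mx vec_dot gram_form big_sumType /= big_ord0 addr0.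
have -> : \tr (V^t* *m U) = \tr ((S^t* *m V *m S)^t* *m (S^t* *m U *m S)).
  have -> : (S^t* *m V *m S)^t* *m (S^t* *m U *m S) = S^t* *m (V^t* *m U) *m S.
    rewrite !trmxCM trmxCK !mulmxA -[_ *m S *m S^t*]mulmxA -SE mulmx1.
    by [].
  by rewrite [RHS]mxtrace_mulC (mulmxA S (S^t*)) -SE mul1mx.
transitivity (\sum_(p : 'I_d * 'I_d) ((S^t* *m V *m S) p.1 p.2)^*%R * (S^t* *m U *m S) p.1 p.2).
  apply: eq_bigr => p _; rewrite mul1r.
  change (\tr (V^t* *m @hvec R d A 0 S (inl p)) * \tr ((@hvec R d A 0 S (inl p))^t* *m U) =
    ((S^t* *m V *m S) p.1 p.2)^*%R * (S^t* *m U *m S) p.1 p.2).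
  rewrite (@hvec_dotr R d A 0 S p U) iS iS'; congr (_ * _).
  have -> : \tr (V^t* *m @hvec R d A 0 S (inl p)) =
      (\tr ((@hvec R d A 0 S (inl p))^t* *m V))^*%R.
    by rewrite -trace_trmxC trmxCM trmxCK.
  by rewrite (@hvec_dotr R d A 0 S p V) iS iS'.
move: (S^t* *m V *m S) (S^t* *m U *m S) => X Y.
rewrite -(pair_bigA _ (fun i j => (X i j)^*%R * Y i j)) /= exchange_big.
apply: eq_bigr => j _; rewrite mxE; apply: eq_bigr => i _.
by rewrite trmxCE.
Qed.

(** Unit trace forces [q i <= 1], so all weights [lam / (q i * q j)] are at least 1 and the
    determinant is at least that of the identity. *)
Lemma Vt0_ge0 (y : 'M[C]_d) : posdefmx y -> \tr y = 1 -> 0 <= Vt lam A 0 y.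
Proof.
move=> yp y1; have [S [q [Su SE iS iS' yE]]] := unitary_diagonalization (posdef_herm yp).
have q0 i : 0 < q i by apply: (@posdef_rdiag_gt0 R d S q i) => //; rewrite -yE.
have q1 i : q i <= 1.
  have : (\sum_i q i)%:C = 1 :> C by rewrite -(tr_rdiag_unitary _ SE) -yE.
  move/complexI => <-; rewrite (bigD1 i) //= lerDl; apply: sumr_ge0 => j _; exact: ltW.
rewrite yE Vt_rdiag //; last by case.
rewrite mulr_ge0 // ln_ge0 //.
have -> : 1 = complex.Re (\det (gram (hvec A (t := 0) S) (fun=> 1))) :> R.
  by rewrite gram_unitary // det1.
apply: gram_det_mono => -[[i j]|[]//] /=; rewrite ler01 /=.
rewrite ler_pdivlMr ?mulr_gt0 // mul1r; apply: le_trans lam_ge1.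
by rewrite -[leRHS]mulr1 ler_pM // ltW.
Qed.

Lemma logdet_density_le0 (y : 'M[C]_d) : posdefmx y -> \tr y = 1 -> ln (complex.Re (\det y)) <= 0.
Proof.
move=> yp y1; apply: ln_le0.
have [S0 _ yE] := yp.
have yP : psdmx y by rewrite yE; exact: sqr_psd.
have /andP[_] := psdmx_det_le_tr yP; rewrite y1 expr1n.
by rewrite lecE => /andP[].
Qed.

Lemma psd_tr_sqr_Re (B : 'M[C]_d) : psd B ->
  complex.Re (\tr (B *m B)) <= complex.Re (\tr B) ^+ 2.
Proof.
move=> Bp; have /andP[_] := psdmx_tr_sqr Bp.
have := psdmx_tr_ge0 Bp; case: (\tr B) => a b; rewrite lecE /= => /andP[/eqP -> _].
by rewrite lecE => /andP[_] /=; rewrite !expr2 /= mulr0 subr0.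
Qed.

Lemma tr_ge_rdiag (B S : 'M[C]_d) q (kap : R) : psd B -> S *m S^t* = 1%:M ->
  (forall i, kap <= q i) ->
  kap * complex.Re (\tr B) <= complex.Re (\tr (B *m (S *m rdiag q *m S^t*))).
Proof.
move=> Bp SE hq.
have trE p : complex.Re (\tr (B *m (S *m rdiag p *m S^t*))) =
    \sum_i p i * complex.Re ((S^t* *m B *m S) i i).
  rewrite mxtrace_mulC -!mulmxA mxtrace_mulC -!mulmxA tr_rdiag_mul Re_sum.
  by apply: eq_bigr => i _; rewrite ReZ mulmxA.
have BE : \tr B = \tr (B *m (S *m rdiag (fun=> 1) *m S^t*)).
  by rewrite rdiag1 mulmx1 SE mulmx1.
rewrite BE (trE (fun=> 1)) (trE q) mulr_sumr; apply: ler_sum => i _.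
rewrite mul1r; apply: ler_wpM2r (hq i).
by have := psdmx_diag_ge0 i (psdmx_congr S Bp); rewrite lecE => /andP[].
Qed.

(* The weights are bounded through [kap <= q i]; the Frobenius norms of the
   vectors are 1 for the matrix units and at most [tr A] for the observations. *)
Lemma Vt_le (t : nat) (kap : R) (S : 'M[C]_d) q : (0 < d)%N -> alive A t -> 0 < kap ->
  S \in unitmx -> 1%:M = S *m S^t* -> invmx S = S^t* -> invmx (S^t*) = S ->
  (forall i, kap <= q i) ->
  Vt lam A t (S *m rdiag q *m S^t*) <=
  2^-1 * ((d * d)%:R * ln ((lam * (d * d)%:R + t%:R) / kap ^+ 2)).
Proof.
move=> d0 Al k0 Su SE iS iS' hq; set y := S *m rdiag q *m S^t*.
have q0 i : 0 < q i by exact: lt_le_trans (hq i).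
have lam0 : 0 < lam by exact: lt_le_trans lam_ge1.
have yp : posdefmx y by exact: posdef_rdiag.
rewrite Vt_rdiag // ler_pM2l // -/y.
set al := fun tau : 'I_t => _; set G := gram _ _.
have al0 i : 0 < al i := alive_tr_gt0 i Al yp.
have w0 k : 0 < hweight lam q al k by exact: hweight_gt0.
have Gp : psdmx G by apply: gram_psd => k; exact: ltW.
have dG : 0 < complex.Re (\det G) by apply/Re_gt0/gram_hvec_det_gt0.
pose T := complex.Re (\tr G).
have detT : complex.Re (\det G) <= T ^+ (d * d).
  have trG : \tr G = T%:C.
    by rewrite /T; have := psdmx_tr_ge0 Gp; case: (\tr G) => a b; rewrite lecE => /andP[/eqP/= ->].
  have /andP[_] := psdmx_det_le_tr Gp; rewrite trG -rmorphXn /= lecE => /andP[_].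
  by [].
have T_le : T <= (lam * (d * d)%:R + t%:R) / kap ^+ 2.
  rewrite /T /G gram_tr Re_sum big_sumType /= mulrDl; apply: lerD.
    have -> : lam * (d * d)%:R / kap ^+ 2 = \sum_(p : 'I_d * 'I_d) lam / kap ^+ 2.
      by rewrite sumr_const card_prod !card_ord -[RHS]mulr_natr mulrAC.
    apply: ler_sum => p _; rewrite ReZ.
    have -> : \tr ((@hvec R d A t S (inl p))^t* *m @hvec R d A t S (inl p)) = 1.
      rewrite (@hvec_dotr R d A t S p _) /hvec iS iS' !mulmxA.
      have -> : S^t* *m S = 1%:M by apply: mulmx1C.
      rewrite mul1mx -mulmxA; have -> : S^t* *m S = 1%:M by apply: mulmx1C.
      by rewrite mulmx1 mxE !eqxx.
    rewrite mulr1 ler_pM2l // lef_pV2 ?posrE ?mulr_gt0 ?exprn_gt0 //.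
    by rewrite expr2 ler_pM // ltW.
  have -> : t%:R / kap ^+ 2 = \sum_(tau < t) (kap ^+ 2)^-1.
    by rewrite sumr_const card_ord -[RHS]mulr_natl.
  apply: ler_sum => tau _; rewrite ReZ.
  have [Ap A0] : psd (A tau.+1) /\ A tau.+1 != 0 by apply: Al; rewrite /= ltn_ord.
  have h1 := psd_tr_sqr_Re Ap.
  have h2 : kap * complex.Re (\tr (A tau.+1)) <= al tau by exact: tr_ge_rdiag.
  have h3 : 0 <= complex.Re (\tr (A tau.+1)).
    by have := psdmx_tr_ge0 Ap; rewrite lecE => /andP[].
  rewrite (hermE Ap.1).
  move: (al tau) (al0 tau) h1 h2 h3.
  move: (complex.Re (\tr (A tau.+1 *m A tau.+1))) (complex.Re (\tr (A tau.+1))) => u v a a0 h1 h2 h3.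
  have kn : kap ^+ 2 != 0 by rewrite gt_eqF // exprn_gt0.
  rewrite exprVn mulrC ler_pdivrMr ?exprn_gt0 // mulrC ler_pdivlMr ?exprn_gt0 //.
  apply: (@le_trans _ _ ((kap * v) ^+ 2)).
    by rewrite exprMn mulrC ler_pM2l // exprn_gt0.
  by rewrite ler_pXn2r // nnegrE; [rewrite mulr_ge0 // ltW|exact: ltW].
have T0 : 0 < T.
  have : 0 < T ^+ (d * d) by exact: lt_le_trans detT.
  have : 0 <= T by have := psdmx_tr_ge0 Gp; rewrite lecE => /andP[].
  rewrite le_eqVlt => /orP[/eqP <-|//].
  by rewrite expr0n muln_eq0 (gtn_eqF d0) ltxx.
apply: (@le_trans _ _ (ln (T ^+ (d * d)))).
  by rewrite ler_ln ?posrE // (lt_le_trans dG).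
rewrite lnXn // -[leLHS]mulr_natl ler_pM2l ?ltr0n ?muln_gt0 ?d0 //.
by rewrite ler_ln ?posrE // (lt_le_trans T0).
Qed.

(** All eigenvalues of the mixture are at least [e / d], which controls both the regulariser and the
    volumetric term, while each trace loses at most the factor [1 - e]. *)
Lemma density_mixture (sigma : 'M[C]_d) (e : R) (t : nat) : (0 < d)%N -> alive A t ->
  density sigma -> 0 < e -> e < 1 ->
  let y := (1 - e)%:C *: sigma + (e / d%:R)%:C *: 1%:M in
  [/\ posdefmx y, \tr y = 1,
    - ln (complex.Re (\det y)) <= d%:R * ln (d%:R / e),
    Vt lam A t y <= 2^-1 * ((d * d)%:R * ln ((lam * (d * d)%:R + t%:R) * (d%:R / e) ^+ 2)) &
    forall B, psd B -> (1 - e) * complex.Re (\tr (B *m sigma)) <= complex.Re (\tr (B *m y))].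
Proof.
move=> d0 Al [sp s1] e0 e1 y.
have dR0 : 0 < d%:R :> R by rewrite ltr0n.
have k0 : 0 < e / d%:R by rewrite divr_gt0.
have [S [p [Su SE iS iS' sE]]] := unitary_diagonalization sp.1.
have p0 i : 0 <= p i.
  have := psdmx_diag_ge0 i (psdmx_congr S sp); rewrite sE.
  have SE' : S^t* *m S = 1%:M by apply: mulmx1C.
  by rewrite !mulmxA SE' mul1mx -mulmxA SE' mulmx1 !mxE eqxx mulr1n lecR.
pose q i := (1 - e) * p i + e / d%:R * 1.
have yE : y = S *m rdiag q *m S^t*.
  rewrite -[RHS](rdiag_affine S p (fun=> 1)) -sE rdiag1 mulmx1 -SE.
  by [].
have hq i : e / d%:R <= q i.
  by rewrite /q mulr1 lerDr mulr_ge0 // subr_ge0 ltW.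
have q0 i : 0 < q i by exact: lt_le_trans (hq i).
have kV : (e / d%:R)^-1 = d%:R / e by rewrite invf_div.
split.
- by rewrite yE; exact: posdef_rdiag.
- rewrite /y linearD !linearZ /= s1 mxtrace1 mulr1.
  have -> : (d%:R : C) = (d%:R : R)%:C by rewrite rmorph_nat.
  transitivity ((1 - e + e / d%:R * d%:R)%:C); first by rewrite -rmorphM -rmorphD.
  by rewrite divfK ?gt_eqF // subrK.
- rewrite yE Re_det_rdiag.
  have -> : complex.Re (`|\det S| ^+ 2) = 1.
    have := Re_det_rdiag S (fun=> 1); rewrite rdiag1 mulmx1 -SE det1 big1_eq mulr1.
    by move=> <-.
  rewrite mul1r ln_prod // -sumrN.
  have -> : d%:R * ln (d%:R / e) = \sum_(i < d) ln (d%:R / e).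
    by rewrite sumr_const card_ord mulr_natl.
  apply: ler_sum => i _; rewrite -kV lnV ?posrE // lerN2 ler_ln ?posrE //.
- rewrite yE; have := @Vt_le t (e / d%:R) S q d0 Al k0 Su SE iS iS' hq.
  by rewrite -exprVn kV.
move=> B Bp; rewrite /y mulmxDr -!scalemxAr linearD !linearZ /= mulmx1.
have : 0 <= complex.Re (\tr B) by have := psdmx_tr_ge0 Bp; rewrite lecE => /andP[].
move: (\tr (B *m sigma)) (\tr B) => a b b0; rewrite ReD !ReZ lerDl.
by rewrite mulr_ge0 // ltW.
Qed.

End density_bounds.

(** * The regret *)

Section regret_bound.
Context {R : realType} {d : nat}.
Local Notation C := R[i].
Variables (T : nat) (A rho : nat -> 'M[C]_d).
Hypothesis d_gt0 : (0 < d)%N.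
Hypothesis play : vbftrl_play 300 10 T A rho.

Lemma loss_neqNy (B M : 'M[C]_d) : loss B M != -oo%E.
Proof. by rewrite /loss /=; case: ifP. Qed.

Lemma loss_eqy (B M : 'M[C]_d) : complex.Re (\tr (B *m M)) <= 0 -> loss B M = +oo%E.
Proof. by move=> h; rewrite /loss /= h. Qed.

Lemma sum_loss_eqy (M : nat -> 'M[C]_d) tau : (1 <= tau <= T)%N ->
  loss (A tau) (M tau) = +oo%E -> (\sum_(1 <= t < T.+1) loss (A t) (M t))%E = +oo%E.
Proof.
move=> h hl; apply/esum_eqyP => [i _|]; first exact: loss_neqNy.
by exists tau; rewrite mem_index_iota ltnS.
Qed.

Lemma regret_dead tau : (1 <= tau <= T)%N -> A tau = 0 -> regret T A rho = -oo%E.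
Proof.
move=> h A0; rewrite /regret.
suff -> : ereal_inf [set (\sum_(1 <= t < T.+1) loss (A t) sigma)%E | sigma in density] = +oo%E.
  (* [x - +oo] is [-oo] here even when [x] is [+oo]. *)
  by rewrite addeNy.
apply/eqP; rewrite -leye_eq; apply/ereal_infP => _ [sigma _ <-].
rewrite (@sum_loss_eqy (fun=> sigma) tau) //; apply: loss_eqy.
by rewrite A0 mul0mx mxtrace0.
Qed.

Hypothesis A_alive : alive A T.

Lemma alive_le t : (t <= T)%N -> alive A t.
Proof.
move=> tT tau /andP[h1 h2]; apply: A_alive.
by rewrite h1 (leq_trans h2).
Qed.

Definition volumetric_part t (M : 'M[C]_d) : R := if t is 0 then 0 else Vt 300 A t M.

Lemma volumetric_part_convex t x y s : alive A t -> posdefmx x -> posdefmx y -> 0 <= s <= 1 ->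
  volumetric_part t ((1 - s)%:C *: x + s%:C *: y) <=
  (1 - s) * volumetric_part t x + s * volumetric_part t y.
Proof.
case: t => [|t] Al xp yp s01; rewrite /volumetric_part.
  by rewrite !mulr0 addr0.
by apply: (Vt_convex _ Al xp yp s01); rewrite ltr0n.
Qed.

Lemma volumetric_part_le_Vt t y : posdefmx y -> \tr y = 1 ->
  volumetric_part t y <= Vt 300 A t y.
Proof.
case: t => [|t] yp y1; rewrite /volumetric_part; last exact: lexx.
by apply: (Vt0_ge0 _ _ yp y1); rewrite ler1n.
Qed.

Lemma Pt_posdef t M : (t <= T)%N -> posdefmx M ->
  Pt 300 10 A t M = (Lreal 300 A t M + 10 * volumetric_part t M)%:E.
Proof.
move=> tT Mp; have Al := alive_le tT; case: t tT Al => [|t] tT Al.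
  rewrite /Pt logdet_reg_fin ?posdef_det_gt0 // -EFinM; congr (_%:E).
  by rewrite /Lreal big_ord0 oppr0 sub0r /= mulr0 addr0 mulrN.
by rewrite /Pt Lt_posdef // -EFinD.
Qed.

Lemma posdef_density (M : 'M[C]_d) : posdefmx M -> \tr M = 1 -> density M.
Proof. by move=> [S Su ->] h; split=> //; exact: sqr_psd. Qed.

Lemma uniform_posdef : exists2 M : 'M[C]_d, posdefmx M & \tr M = 1.
Proof.
have h0 : 0 < d%:R^-1 :> R by rewrite invr_gt0 ltr0n.
exists (1%:M *m rdiag (fun=> d%:R^-1) *m (1%:M)^t*).
  by apply: posdef_rdiag => //; exact: unitmx1.
rewrite trmx1 map_mx1 mulmx1 mul1mx mxtrace_diag.
under eq_bigr do rewrite mxE.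
rewrite sumr_const card_ord -rmorphMn /= -[_ *+ d]mulr_natr mulVf //.
by rewrite gt_eqF // ltr0n.
Qed.

(** A singular density matrix costs [+oo], whereas the uniform state has finite cost. No loss is
    [-oo], so nothing can cancel the infinite regulariser. *)
Lemma rho_posdef t : (t < T)%N -> posdefmx (rho t.+1) /\ \tr (rho t.+1) = 1.
Proof.
move=> tT; have [_ [[rp r1] rmin]] : psd (A t.+1) /\ argmin_density (Pt 300 10 A t) (rho t.+1).
  exact: play.
split=> //; apply: psd_posdef => //; rewrite ltNge; apply/negP => det0.
have [M Mp M1] := uniform_posdef.
have := rmin M (posdef_density Mp M1); rewrite (Pt_posdef (ltnW tT) Mp).
suff -> : Pt 300 10 A t (rho t.+1) = +oo%E by rewrite leye_eq.
have ly : (300%:E * logdet_reg (rho t.+1))%E = +oo%E :> \bar R.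
  rewrite /logdet_reg /= det0 /=; apply: gt0_muley.
  by rewrite lte_fin ltr0n.
case: t tT {rp r1 rmin} det0 ly => [|t] tT det0 ly; first exact: ly.
rewrite /Pt /Lt ly addey ?addye //.
by apply/eqP => /esum_eqNyP[i [_ _ /eqP]]; rewrite (negbTE (loss_neqNy _ _)).
Qed.

(** [y] varies in the induction because the hypothesis for [t] is applied at [rho t.+1]. The base
    case is the nonnegativity of [P_0] on density matrices. *)
Lemma cumulative_loss_le t (y : 'M[C]_d) : (t <= T)%N -> posdefmx y -> \tr y = 1 ->
  - (\sum_(i < t) ln (complex.Re (\tr (A i.+1 *m rho i.+1)))) <=
  Lreal 300 A t y + 10 * volumetric_part t y.
Proof.
elim: t y => [|t IH] y tT yp y1.
  rewrite big_ord0 oppr0 /Lreal big_ord0 oppr0 sub0r /= mulr0 addr0 -mulrN.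
  by apply: mulr_ge0; [rewrite ler0n|rewrite oppr_ge0; exact: logdet_density_le0].
have [xp x1] := rho_posdef tT; have tT' := ltnW tT.
have := IH _ tT' xp x1.
have step := @vbftrl_step R d A d_gt0 t (volumetric_part t) (rho t.+1) y (alive_le tT) xp yp.
have : Lreal 300 A t (rho t.+1) + 10 * volumetric_part t (rho t.+1)
   - ln (complex.Re (\tr (A t.+1 *m rho t.+1))) <= Lreal 300 A t.+1 y + 10 * Vt 300 A t.+1 y.
  apply: step.
    move=> s s01 z.
    have s01' : 0 <= s <= 1 by case/andP: s01 => s0 s1; rewrite !ltW.
    have zp : posdefmx z.
      have [S [q [Su xE yE]]] := real_simultaneous_diagonalization xp (posdef_herm yp).
      rewrite /z xE yE segment_rdiag; apply: posdef_rdiag => // i.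
      have q0 : 0 < q i by apply: (@posdef_rdiag_gt0 R d S q i) => //; rewrite -yE.
      by case/andP: s01 => s0 s1; nra.
    have z1 : \tr z = 1.
      by rewrite /z linearD !linearZ /= x1 y1 !mulr1 -rmorphD subrK.
    split.
      have [_ [_ rmin]] : psd (A t.+1) /\ argmin_density (Pt 300 10 A t) (rho t.+1).
        exact: play.
      by have := rmin z (posdef_density zp z1); rewrite !Pt_posdef // lee_fin.
    exact: volumetric_part_convex (alive_le tT') xp yp s01'.
  exact: volumetric_part_le_Vt.
rewrite big_ord_recr /=.
move: (\sum_(i < t) _) (Lreal _ _ _ _) (Lreal _ _ _ _) (volumetric_part _ _) (Vt _ _ _ _) (ln _).
by move=> a b c e f g h1 h2; clear -h1 h2; lra.
Qed.

End regret_bound.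

(** With [l = ln (T + d) >= 1/2], the three terms are at most [2], [300 * 2] and [5 * 15] times
    [d^2 l], which add up to 677. *)
Lemma regret_rate_arith (R : realType) (d T : nat) : (0 < d)%N -> (0 < T)%N ->
  1 + 300 * (d%:R * ln (d%:R / (T.+1%:R)^-1))
  + 10 * (2^-1 * ((d * d)%:R * ln ((300 * (d * d)%:R + T%:R) * (d%:R / (T.+1%:R)^-1) ^+ 2)))
  <= 677 * d%:R ^+ 2 * ln ((T + d)%:R) :> R.
Proof.
move=> d0 T0; rewrite natrM natrD -[T.+1%:R]natr1.
have d1 : 1 <= d%:R :> R by rewrite ler1n.
have T1 : 1 <= T%:R :> R by rewrite ler1n.
move: d1 T1; move: (d%:R : R) (T%:R : R) => D N D1 N1.
rewrite invrK; set n := N + D.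
have n2 : 2 <= n by rewrite /n; lra.
have n0 : 0 < n by lra.
have ln2 : 2^-1 <= ln n.
  apply: le_trans (ln_ge_1subV n0).
  have : n^-1 <= 2^-1 by rewrite lef_pV2 ?posrE //; lra.
  lra.
have dn : D * (N + 1) <= n ^+ 2 by rewrite /n; nra.
have dn0 : 0 < D * (N + 1) by nra.
have l1 : ln (D * (N + 1)) <= 2 * ln n.
  have -> : 2 * ln n = ln (n ^+ 2) by rewrite lnXn // mulr_natl.
  by rewrite ler_ln ?posrE // exprn_gt0.
have q0 : 0 < 300 * (D * D) + N by nra.
(* The exponent is [9 + 2], as [300 <= 2 ^ 9 <= n ^ 9]; together with [(n ^ 2) ^ 2] it yields the
   factor 15 below. *)
have q1 : 300 * (D * D) + N <= n ^+ 11.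
  have h9 : 300 <= n ^+ 9.
    have : (2 : R) ^+ 9 <= n ^+ 9 by rewrite ler_pXn2r // nnegrE //; lra.
    apply: le_trans; rewrite -natrX ler_nat; by [].
  have h2 : 300 * (D * D) + N <= 300 * n ^+ 2 by rewrite /n; nra.
  apply: le_trans h2 _.
  have -> : n ^+ 11 = n ^+ 9 * n ^+ 2 by rewrite -exprD.
  by rewrite ler_wpM2r // sqr_ge0.
have l2 : ln (300 * (D * D) + N) <= 11 * ln n.
  have -> : 11 * ln n = ln (n ^+ 11) by rewrite lnXn // mulr_natl.
  by rewrite ler_ln ?posrE // exprn_gt0.
have l3 : ln ((300 * (D * D) + N) * (D * (N + 1)) ^+ 2) <= 15 * ln n.
  rewrite lnM ?posrE ?exprn_gt0 // lnXn // mulr2n; lra.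
move: l1 l3 ln2; move: (ln (_ * _)) (ln (D * (N + 1))) (ln n) => b a l l1 l3 ln2.
have D2 : 1 <= D ^+ 2 by rewrite expr2; nra.
have t1 : 1 <= 2 * (D ^+ 2 * l) by nra.
have t2 : D * a <= 2 * (D ^+ 2 * l).
  have : D * a <= D * (2 * l) by rewrite ler_pM2l //; lra.
  have : D * l <= D ^+ 2 * l by rewrite ler_pM2r ?expr2; nra.
  lra.
have t3 : D * D * b <= 15 * (D ^+ 2 * l).
  by rewrite -expr2 mulrCA ler_pM2l //; lra.
rewrite -[677 * _ * _]mulrA; move: t1 t2 t3; move: (D ^+ 2 * l) (D * a) (D * D * b) => u v x t1 t2 t3.
by clear -t1 t2 t3; lra.
Qed.

Lemma regret_alive (R : realType) (d T : nat) (A rho : nat -> 'M[R[i]]_d) :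
  (0 < d)%N -> (0 < T)%N -> vbftrl_play 300 10 T A rho -> alive A T ->
  (regret T A rho <= (677 * d%:R ^+ 2 * ln ((T + d)%:R))%:E)%E.
Proof.
move=> d0 T0 play Al; set K := 677 * _ * _.
pose F : R := - (\sum_(i < T) ln (complex.Re (\tr (A i.+1 *m rho i.+1)))).
have sumF : (\sum_(1 <= t < T.+1) loss (A t) (rho t))%E = F%:E.
  rewrite big_add1 big_mkord /F -sumrN -sumEFin; apply: eq_bigr => i _.
  have [rp _] := rho_posdef d0 play Al (ltn_ord i).
  by rewrite loss_fin //; exact: alive_tr_gt0 Al rp.
suff inf_ge : ((F - K)%:E <= ereal_inf [set (\sum_(1 <= t < T.+1) loss (A t) sigma)%E
    | sigma in density])%E.
  rewrite /regret sumF; move: inf_ge; case: (ereal_inf _) => [r| |] //.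
  - by rewrite -EFinB !lee_fin; clearbody K F => h; lra.
  - by rewrite addeNy leNye.
apply/ereal_infP => _ [sigma sd <-].
(* A comparator with a vanishing trace has infinite loss; the mixture is needed only when all traces
   are positive. *)
have [/existsP[tau htau]|] := boolP [exists tau : 'I_T, complex.Re (\tr (A tau.+1 *m sigma)) <= 0].
  rewrite (@sum_loss_eqy R d T A (fun=> sigma) tau.+1) ?leey //; last exact: loss_eqy.
  by rewrite /= ltn_ord.
rewrite negb_exists => /forallP htau.
have sig0 (i : 'I_T) : 0 < complex.Re (\tr (A i.+1 *m sigma)) by rewrite ltNge htau.
rewrite big_add1 big_mkord.
rewrite (eq_bigr (fun i : 'I_T => (- ln (complex.Re (\tr (A i.+1 *m sigma))))%:E)) => [|i _]; last first.
  by rewrite loss_fin.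
rewrite sumEFin lee_fin.
pose e : R := (T.+1%:R)^-1.
have T10 : 0 < T.+1%:R :> R by rewrite ltr0n.
have e0 : 0 < e by rewrite invr_gt0.
have e1 : e < 1 by rewrite invf_lt1 // ltr1n ltnS.
have lam1 : 1 <= 300 :> R by rewrite ler1n.
have := density_mixture lam1 d0 Al sd e0 e1; rewrite /=.
set y := _ + _; move=> [yp y1 dety Vy try].
have main : F <= Lreal 300 A T y + 10 * volumetric_part A T y.
  exact: (@cumulative_loss_le R d T A rho d0 play Al T y (leqnn T) yp y1).
have VE : volumetric_part A T y = Vt 300 A T y by move: T0; case: (T).
(* Since [1 - e = T / (T + 1)], this is [T * ln (1 + 1 / T) <= 1]: mixing costs at most 1 over all
   rounds together. *)
have lnT : - (T%:R * ln (1 - e)) <= 1.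
  have -> : 1 - e = T%:R / T.+1%:R.
    by rewrite /e -[T.+1%:R]natr1; field; rewrite natr1 gt_eqF.
  have TR : 0 < T%:R :> R by rewrite ltr0n.
  have := @ln_le_sub1 R (T.+1%:R / T%:R) (divr_gt0 T10 TR).
  rewrite !ln_div ?posrE // => h.
  have := ler_wpM2l (ltW TR) h; rewrite /=.
  have -> : T%:R * (T.+1%:R / T%:R - 1) = 1 :> R.
    by rewrite -[T.+1%:R]natr1; field; rewrite gt_eqF.
  by clear; move: (ln _) (ln _) => a b h; lra.
have losses : - (\sum_(i < T) ln (complex.Re (\tr (A i.+1 *m y)))) <=
    - (\sum_(i < T) ln (complex.Re (\tr (A i.+1 *m sigma)))) + 1.
  apply: le_trans (_ : - (\sum_(i < T) (ln (1 - e) + ln (complex.Re (\tr (A i.+1 *m sigma))))) <= _).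
    rewrite lerN2; apply: ler_sum => i _.
    have e10 : 0 < 1 - e by rewrite subr_gt0.
    rewrite -lnM ?posrE // ler_ln ?posrE ?mulr_gt0 //; last exact: alive_tr_gt0 Al yp.
    by apply: try; case: (Al i.+1) => //; rewrite /= ltn_ord.
  rewrite big_split /= sumr_const card_ord -mulr_natl opprD addrC lerD2l.
  exact: lnT.
have arith := @regret_rate_arith R d T d0 T0.
rewrite sumrN lerBlDr.
apply: (le_trans main); rewrite VE /Lreal.
move: losses dety Vy arith; rewrite -/K -/e.
move: (\sum_(i < T) _) (\sum_(i < T) _) (ln (complex.Re _)) (Vt _ _ _ _) => a b c v.
move: (d%:R * ln _) (2^-1 * _) => p q h1 h2 h3 h4; clearbody K.
by clear -h1 h2 h3 h4; lra.
Qed.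

Theorem theorem3p1 :
  forall R : realType, exists C : R,
  forall (d T : nat) (A rho : nat -> 'M[R[i]]_d),
    (0 < d)%N -> (0 < T)%N ->
    vbftrl_play 300 10 T A rho ->
    (regret T A rho <= (C * d%:R ^+ 2 * ln ((T + d)%:R))%:E)%E.
Proof.
move=> R; exists 677 => d T A rho d0 T0 play.
have [[tau htau A0]|nodead] := pselect (exists2 tau, (1 <= tau <= T)%N & A tau = 0).
  by rewrite (regret_dead rho htau A0) leNye.
apply: regret_alive => // tau htau; split; first by have [] := play tau htau.
by apply/eqP => A0; apply: nodead; exists tau.
Qed.
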